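(* Let $T>0$, let $1\le q\le\infty$ and $1\le p<\infty$ be such that $$p<1+\frac1q ,$$ and let $\tilde q,\tilde p\in[1,\infty)$ be arbitrary (arbitrarily large) exponents. Then there is a force $f\in L^q(0,T;L^p(D))$ such that the corresponding unique solution $v$ (with pressure $P$) of the Navier-Stokes equations $$\Delta v-v\cdot\nabla v-\nabla P-\partial_t v=f,\qquad \nabla\cdot v=0\qquad\text{in } D\times[0,T),$$ satisfying the no slip boundary condition $v=0$ on the vertical boundary of $D$ and the Navier total slip boundary condition on the horizontal boundary of $D$, has the following properties: $f$ and $v$ are smooth in $D\times[0,T)$ (so blow up occurs only at time $T$), $v\in L^{\tilde q}(0,T;L^{\tilde p}(D))$, and $$\lim_{t\to T}\|v(\cdot,t)\|_{L^\infty(D)}=+\infty .$$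
   Context: $D=B_2(0,1)\times[0,1]\subset\mathbb{R}^3$ is the cylinder, where $B_2(0,1)$ is the unit ball of $\mathbb{R}^2$ centred at the origin. Its vertical boundary is the lateral surface $\{x_1^2+x_2^2=1,\ 0\le x_3\le 1\}$ and its horizontal boundary consists of the top and bottom faces $x_3\in\{0,1\}$. With cylindrical components $v_r=v\cdot e_r$, $v_\theta=v\cdot e_\theta$, $v_3=v\cdot e_3$, the Navier total slip boundary condition on the horizontal boundary is $\partial_{x_3}v_r=\partial_{x_3}v_\theta=0$, $v_3=0$. The velocity $v$ and force $f$ are $\mathbb{R}^3$-valued and $P$ is scalar; the Navier-Stokes problem carries an initial condition $v(x,0)=v_0(x)$, where $v_0$ is the value of $v$ at $t=0$ (the existence statement includes the existence of such an initial value). ''Unique'' means that $v$ is the only velocity field, among solutions smooth for $t<T$, solving the problem with the given $f$, initial value and boundary conditions. Convention: $1/\infty=0$ (so the hypothesis on $(q,p)$ forces $q<\infty$). *)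

(* Defs.v *)
From HB Require Import structures.
From mathcomp Require Import all_boot all_order all_algebra.
From mathcomp Require Import all_classical all_reals all_analysis.

Set Implicit Arguments.
Unset Strict Implicit.
Unset Printing Implicit Defensive.

Import Order.TTheory GRing.Theory Num.Theory.
Import numFieldNormedType.Exports.

Local Open Scope classical_set_scope.
Local Open Scope ring_scope.

(* The Cartesian coordinates x_1, x_2, x_3 have indices 0, 1, 2. *)
Definition i1 : 'I_3 := @Ordinal 3 0 isT.
Definition i2 : 'I_3 := @Ordinal 3 1 isT.
Definition i3 : 'I_3 := @Ordinal 3 2 isT.

(* Vectors carry the Euclidean norm; the library norm on ['rV[R]_3] is the max
   norm. *)
Definition dotv (R : realType) (u w : 'rV[R]_3) : R := \sum_(i < 3) u 0 i * w 0 i.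
Definition enorm (R : realType) (u : 'rV[R]_3) : R := Num.sqrt (dotv u u).

Definition radius (R : realType) (x : 'rV[R]_3) : R :=
  Num.sqrt (x 0 i1 ^+ 2 + x 0 i2 ^+ 2).

(* Meaningful only off the axis, i.e. for [radius x != 0]. *)
Definition e_r (R : realType) (x : 'rV[R]_3) : 'rV[R]_3 :=
  (radius x)^-1 *: (x 0 i1 *: delta_mx 0 i1 + x 0 i2 *: delta_mx 0 i2).
Definition e_theta (R : realType) (x : 'rV[R]_3) : 'rV[R]_3 :=
  (radius x)^-1 *: (- x 0 i2 *: delta_mx 0 i1 + x 0 i1 *: delta_mx 0 i2).

Definition cylinder (R : realType) : set 'rV[R]_3 :=
  [set x | radius x <= 1 /\ 0 <= x 0 i3 <= 1].
Definition vertical_boundary (R : realType) : set 'rV[R]_3 :=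
  [set x | radius x = 1 /\ 0 <= x 0 i3 <= 1].
Definition horizontal_boundary (R : realType) : set 'rV[R]_3 :=
  [set x | radius x <= 1 /\ (x 0 i3 = 0 \/ x 0 i3 = 1)].

Notation triple R :=
  (measurableTypeR R * measurableTypeR R * measurableTypeR R)%type.
Notation spacetime R := ('rV[R]_3 * R)%type.

(* The set D x [0, T). *)
Definition domain (R : realType) (T : R) : set (spacetime R) :=
  @cylinder R `*` [set t | 0 <= t < T].

(* [Some j] is the direction of x_(j+1), [None] is the direction of time. *)
Definition dir (R : realType) (d : option 'I_3) : spacetime R :=
  if d is Some j then (delta_mx 0 j, 0) else (0, 1).

Definition partial (R : realType) (W : normedModType R) (d : option 'I_3)
    (u : spacetime R -> W) : spacetime R -> W :=
  fun z => 'D_(dir R d) u z.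

Definition iter_partial (R : realType) (W : normedModType R)
    (s : seq (option 'I_3)) (u : spacetime R -> W) : spacetime R -> W :=
  foldr (@partial R W) u s.

Definition smooth_on_open (R : realType) (W : normedModType R)
    (U : set (spacetime R)) (u : spacetime R -> W) : Prop :=
  forall s z, U z ->
    {for z, continuous (iter_partial s u)} /\
    forall d, derivable (iter_partial s u) z (dir R d).

(* Smoothness on a set that need not be open: smoothness on some open
   neighbourhood. Derivatives at the boundary points of the cylinder and at
   time 0 are then ordinary derivatives, and by continuity they depend only on
   the values of u on [A] when [A] is [domain T]. *)
Definition smooth_on (R : realType) (W : normedModType R)
    (A : set (spacetime R)) (u : spacetime R -> W) : Prop :=
  exists U : set (spacetime R), [/\ open U, A `<=` U & smooth_on_open U u].

Section NavierStokes.
Variable R : realType.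
Implicit Types (v f : spacetime R -> 'rV[R]_3) (P : spacetime R -> R).

Definition laplacian v z : 'rV[R]_3 :=
  \sum_(j < 3) partial (Some j) (partial (Some j) v) z.

Definition advection v z : 'rV[R]_3 :=
  \sum_(j < 3) v z 0 j *: partial (Some j) v z.

Definition grad P z : 'rV[R]_3 := \row_(j < 3) partial (Some j) P z.

Definition divergence v z : R := \sum_(j < 3) partial (Some j) v z 0 j.

Definition no_slip (T : R) v : Prop :=
  forall x t, vertical_boundary x -> 0 <= t < T -> v (x, t) = 0.

(* The conditions on v_r and v_theta are imposed off the axis, where these
   components are defined. *)
Definition total_slip (T : R) v : Prop :=
  forall x t, horizontal_boundary x -> 0 <= t < T ->
    v (x, t) 0 i3 = 0 /\
    (0 < radius x ->
      partial (Some i3) (fun z => dotv (v z) (e_r z.1)) (x, t) = 0 /\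
      partial (Some i3) (fun z => dotv (v z) (e_theta z.1)) (x, t) = 0).

(* [(v, P)] is a smooth solution, on D x [0, T), of the Navier-Stokes problem
   with force [f] and initial value [v0]. *)
Record NS_solution (T : R) f (v0 : 'rV[R]_3 -> 'rV[R]_3) v P : Prop := {
  NS_smooth_velocity : smooth_on (domain T) v ;
  NS_smooth_pressure : smooth_on (domain T) P ;
  NS_momentum : forall z, domain T z ->
    laplacian v z - advection v z - grad P z - partial None v z = f z ;
  NS_incompressible : forall z, domain T z -> divergence v z = 0 ;
  NS_initial : forall x, cylinder x -> v (x, 0) = v0 x ;
  NS_no_slip : no_slip T v ;
  NS_total_slip : total_slip T v }.

Definition point3 (y : triple R) : 'rV[R]_3 :=
  y.1.1 *: delta_mx 0 i1 + y.1.2 *: delta_mx 0 i2 + y.2 *: delta_mx 0 i3.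

(* Lebesgue measure of R^3, on triples since ['rV[R]_3] has no measurable
   structure in the library; [point3] identifies the two. *)
Definition lebesgue_measure3 : {measure set (triple R) -> \bar R} :=
  ((@lebesgue_measure R \x @lebesgue_measure R) \x @lebesgue_measure R)%E.

(* The norm of L^p(D), for an extended exponent p. *)
Definition LpD (p : \bar R) (g : 'rV[R]_3 -> 'rV[R]_3) : \bar R :=
  'N[lebesgue_measure3]_p[
    (fun y => (enorm (g (point3 y)))%:E) \_ (point3 @^-1` @cylinder R)].

(* The norm of L^q(0, T; L^p(D)). *)
Definition LqLpD (T : R) (q p : \bar R) (g : spacetime R -> 'rV[R]_3) : \bar R :=
  'N[@lebesgue_measure R]_q[
    (fun t => LpD p (fun x => g (x, t))) \_ `]0, T[%classic].

Definition in_LqLpD (T : R) (q p : \bar R) (g : spacetime R -> 'rV[R]_3) : Prop :=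
  (forall i, measurable_fun
     ((point3 @^-1` @cylinder R) `*` `]0, T[%classic :
        set (triple R * measurableTypeR R))
     (fun z : triple R * measurableTypeR R => g (point3 z.1, z.2) 0 i)) /\
  (LqLpD T q p g < +oo)%E.

End NavierStokes.

(* Main.v *)
Require Import Defs.
From HB Require Import structures.
From mathcomp Require Import all_boot all_order all_algebra.
From mathcomp Require Import all_classical all_reals all_analysis.
From mathcomp Require Import measurable_realfun ess_sup_inf ring lra.

Set Implicit Arguments.
Unset Strict Implicit.
Unset Printing Implicit Defensive.

Import Order.TTheory GRing.Theory Num.Theory.
Import numFieldNormedType.Exports.

Local Open Scope classical_set_scope.
Local Open Scope ring_scope.

(** The solution is an explicit vortex about the axis of the cylinder,
      v = (1 - s) (s + T - t)^(-b) (- x_2, x_1, 0),   s = x_1^2 + x_2^2,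
    with zero pressure and [b] slightly larger than 1 / 2; the force is defined
    as what the momentum equation leaves. The field is divergence free because it
    rotates with an angular velocity that only depends on [s], it vanishes for
    s = 1, and it does not depend on x_3, which gives the slip condition. At
    s = T - t its modulus is of the order (T - t)^(1/2 - b), so it blows up in
    the supremum norm ([vortex_blows_up]).

    Write Y = s + T - t, the squared parabolic distance to the axis at time T.
    The velocity is O(Y^(1/2 - b)); a space derivative costs a factor Y^(-1/2)
    and a time derivative a factor Y^(-1), so the force is O(Y^(-b - 1/2))
    ([weighted_derive], [weighted_bound], [weighted_force]). If
    b + 1/2 = al + be with al q < 1 and be p < 1, then Y^(-b - 1/2) is at most
    (T - t)^(-al) times powers with exponent - be / 2 of x_1^2 + (T - t) / 2 and
    x_2^2 + (T - t) / 2. The p-th power of the horizontal factors has an integral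
    bounded uniformly in t, and the q-th power of the time factor is integrable
    ([in_LqLpD_of_bound]). Such [al] and [be] exist for [b] close to 1 / 2 as soon
    as 1 / p + 1 / q > 1, which p < 1 + 1 / q implies ([exponents_exist]). The
    same estimate with be = 0 puts the velocity in every space of finite
    exponents, provided b - 1 / 2 is small.

    Uniqueness holds among all smooth solutions ([NS_solution_unique]). Let u be
    the difference of two solutions, w the second velocity, q the pressure
    difference and phi = |u|^2 / 2. Then d_t phi is at most the divergence of
    u . grad u - w phi - u q plus K phi, where K bounds the gradient of the first
    velocity. The flux vanishes on the boundary: u = 0 on the lateral part, while
    on the faces u_3 = w_3 = 0 and the vertical derivatives of u_1 and u_2 are
    zero. Integrating exp(- K t) phi over the cylinder and [0, t_1] with Fubini
    gives a nonpositive total energy at time t_1 ([energy_vanishes]). The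
    divergence theorem is obtained from the fundamental theorem of calculus on
    the lines parallel to the axes ([integral_lateral], [integral_horizontal]). *)

(** * Space-time points and product measurability *)

Section Measurability.
Variable R : realType.
Local Notation mu := (@lebesgue_measure R).

Definition event (y : triple R) (t : R) : spacetime R := (point3 y, t).

Lemma point3E (y : triple R) :
  (point3 y 0 i1 = y.1.1) * (point3 y 0 i2 = y.1.2) * (point3 y 0 i3 = y.2).
Proof. by rewrite /point3 !mxE/= !(mulr0, mulr1, addr0, add0r). Qed.

Lemma point3_surj (x : 'rV[R]_3) : point3 (x 0 i1, x 0 i2, x 0 i3) = x.
Proof.
apply/rowP => -[[|[|[|//]]] i]; rewrite /point3 !mxE/= !(mulr0, mulr1, addr0, add0r);
  by congr (x _ _); apply/val_inj.
Qed.

Lemma ball_event (z z' : triple R * measurableTypeR R) (e : R) :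
  `|z.1.1.1 - z'.1.1.1| < e -> `|z.1.1.2 - z'.1.1.2| < e ->
  `|z.1.2 - z'.1.2| < e -> `|z.2 - z'.2| < e ->
  ball (event z.1 z.2) e (event z'.1 z'.2).
Proof.
move=> h1 h2 h3 ht; split => //=; split; first exact: le_lt_trans h1.
move=> i j; rewrite ord1.
rewrite -ball_normE/=.
case: j => [[|[|[|//]]] Hj].
- by rewrite (_ : Ordinal Hj = i1) ?point3E//; exact/val_inj.
- by rewrite (_ : Ordinal Hj = i2) ?point3E//; exact/val_inj.
- by rewrite (_ : Ordinal Hj = i3) ?point3E//; exact/val_inj.
Qed.

Definition box (c : (R * R * R) * R) (e : R) : set (triple R * measurableTypeR R) :=
  (((`]c.1.1.1 - e, c.1.1.1 + e[%classic `*` `]c.1.1.2 - e, c.1.1.2 + e[%classic)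
    `*` `]c.1.2 - e, c.1.2 + e[%classic) `*` `]c.2 - e, c.2 + e[%classic).

Lemma measurable_box c e : measurable (box c e).
Proof. by apply: measurableX => //; apply: measurableX => //; apply: measurableX. Qed.

Lemma boxP c e z : box c e z <->
  [/\ `|z.1.1.1 - c.1.1.1| < e, `|z.1.1.2 - c.1.1.2| < e,
      `|z.1.2 - c.1.2| < e & `|z.2 - c.2| < e].
Proof.
have E (a b : R) : (a \in `]b - e, b + e[) = (`|a - b| < e).
  by rewrite ltr_distl in_itv/=.
rewrite /box /=; split.
  by move=> [[[a b] d] f]; rewrite -!E; split.
by rewrite -!E => -[a b d f]; split => //; split.
Qed.

(** Rational boxes form a countable basis, so the product sigma-algebra contains
    the open sets. *)
Lemma open_measurable_event (O : set (spacetime R)) : open O ->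
  measurable [set z : triple R * measurableTypeR R | O (event z.1 z.2)].
Proof.
move=> oO; set A := (X in measurable X).
pose c (k : rat * rat * rat * rat * nat) : (R * R * R) * R :=
  (ratr k.1.1.1.1, ratr k.1.1.1.2, ratr k.1.1.2, ratr k.1.2).
pose B k := box (c k) k.2.+1%:R^-1.
have -> : A = \bigcup_k (if `[< B k `<=` A >] then B k else set0).
  apply/seteqP; split=> [z Az|z [k _]]; last first.
    by case: ifPn => // /asboolP; exact.
  have [e /= e0 he] : nbhs_ball (event z.1 z.2) O.
    by rewrite nbhs_ballE; move: oO; rewrite openE; exact.
  (* a box of half-width 1 / (n + 1) around a nearby rational point has diameter
     less than e *)
  have [n ne] : exists n : nat, n.+1%:R^-1 < e / 2.
    have e20 : 0 < e / 2 by rewrite divr_gt0.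
    by have [n] := ltr_add_invr e20; rewrite add0r; exists n.
  have n0 : 0 < n.+1%:R^-1 :> R by [].
  have q_ (a : R) : exists q : rat, `|a - ratr q| < n.+1%:R^-1.
    have /rat_in_itvoo[q] : a - n.+1%:R^-1 < a + n.+1%:R^-1.
      by rewrite ltrBlDr -addrA ltrDl addr_gt0.
    by rewrite in_itv/= -ltr_distl distrC; exists q.
  have [q1 h1] := q_ z.1.1.1; have [q2 h2] := q_ z.1.1.2.
  have [q3 h3] := q_ z.1.2; have [q4 h4] := q_ z.2.
  exists (q1, q2, q3, q4, n) => //.
  have Bz : B (q1, q2, q3, q4, n) z by apply/boxP.
  rewrite ifT//; apply/asboolP => w /boxP[/= w1 w2 w3 w4].
  have near_e (a a' b : R) : `|a - b| < n.+1%:R^-1 -> `|a' - b| < n.+1%:R^-1 ->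
      `|a - a'| < e.
    move=> ab a'b; rewrite -(subrKA b) (le_lt_trans (ler_normD _ _))//.
    rewrite [e]splitr ltrD ?(lt_trans ab)//.
    by rewrite distrC (lt_trans a'b).
  by apply: he; apply: ball_event; [exact: near_e h1 w1|exact: near_e h2 w2
    |exact: near_e h3 w3|exact: near_e h4 w4].
apply: countable_bigcupT_measurable => // k.
by case: ifP => // _; exact: measurable_box.
Qed.

(** Continuity is asked at the points of [A] only, not on a neighbourhood: the
    preimage of an open set agrees on [A] with its interior. *)
Lemma continuous_measurable_event (A : set (spacetime R)) (h : spacetime R -> R) :
  measurable [set z : triple R * measurableTypeR R | A (event z.1 z.2)] ->
  (forall z, A z -> {for z, continuous h}) ->
  measurable_fun [set z : triple R * measurableTypeR R | A (event z.1 z.2)]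
    (fun z : triple R * measurableTypeR R => h (event z.1 z.2)).
Proof.
move=> mA ch; apply: (measurability _ (@RGenOInfty.measurableE R)) => //.
move=> _ [_ [a ->] <-].
set O := `]a, +oo[%classic.
rewrite (_ : _ `&` _ = [set z : triple R * measurableTypeR R | A (event z.1 z.2)] `&`
   [set z | (h @^-1` O)^° (event z.1 z.2)]).
  by apply: measurableI => //; apply: open_measurable_event; exact: open_interior.
apply/seteqP; split => z /= [Az hz]; split => //.
  by apply: (ch _ Az); apply: open_nbhs_nbhs; split => //; exact: interval_open.
exact: (interior_subset hz).
Qed.

End Measurability.

(** * The closed cylinder *)

Section Slab.
Variable R : realType.
Local Notation mu := (@lebesgue_measure R).

Lemma lebesgue_itv_lty (a b : R) : (mu `[a, b]%classic < +oo)%E.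
Proof. by rewrite lebesgue_measure_itv/=; case: ifP; rewrite ?ltry// -EFinB ltry. Qed.

Definition D3 : set (triple R) := (@point3 R) @^-1` @cylinder R.

Lemma radius_le1 (x : 'rV[R]_3) :
  (Defs.radius x <= 1) = (x 0 i1 ^+ 2 + x 0 i2 ^+ 2 <= 1).
Proof. by rewrite /Defs.radius -[X in _ <= X]sqrtr1 ler_sqrt. Qed.

Lemma D3P (y : triple R) :
  D3 y <-> y.1.1 ^+ 2 + y.1.2 ^+ 2 <= 1 /\ 0 <= y.2 <= 1.
Proof. by rewrite /D3 /cylinder /= radius_le1 !point3E. Qed.

Lemma measurable_D3 : measurable D3.
Proof.
rewrite (_ : D3 = ((fun y : triple R => y.1.1 ^+ 2 + y.1.2 ^+ 2) @^-1` `]-oo, 1])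
    `&` (snd @^-1` `[0, 1])); last first.
  by apply/seteqP; split => y /=; rewrite D3P !in_itv/=.
have m1 : measurable_fun setT (fun y : triple R => y.1.1 ^+ 2 + y.1.2 ^+ 2).
  by apply: measurable_funD; apply: measurable_funX => //; exact: measurableT_comp.
have m2 : measurable_fun setT (snd : triple R -> measurableTypeR R) by [].
by apply: measurableI; rewrite -[X in measurable X]setTI; [exact: m1|exact: m2].
Qed.

Lemma coord_cts (j : 'I_3) : continuous (fun x : 'rV[R]_3 => x 0 j).
Proof. exact: coord_continuous. Qed.

Lemma closed_cylinder : closed (@cylinder R).
Proof.
rewrite (_ : @cylinder R = ((fun x : 'rV[R]_3 => x 0 i1 ^+ 2 + x 0 i2 ^+ 2) @^-1` [set r | r <= 1])
    `&` ((fun x : 'rV[R]_3 => x 0 i3) @^-1` [set r | r >= 0])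
    `&` ((fun x : 'rV[R]_3 => x 0 i3) @^-1` [set r | r <= 1])); last first.
  apply/seteqP; split => x; rewrite /cylinder/= radius_le1; first by move=> [? /andP[? ?]].
  by move=> [[? ?] ?]; split => //; apply/andP.
apply: closedI; [apply: closedI|]; apply: closed_comp; try exact: closed_ge; try exact: closed_le.
- move=> x _ /=; apply: (@continuousD _ _ _ (fun x : 'rV[R]_3 => x 0 i1 ^+2)
    (fun x : 'rV[R]_3 => x 0 i2 ^+ 2)).
  + by apply: (@continuous_comp _ _ _ (fun x : 'rV[R]_3 => x 0 i1) (fun r => r ^+ 2));
      [exact: coord_cts|exact: exprn_continuous].
  + by apply: (@continuous_comp _ _ _ (fun x : 'rV[R]_3 => x 0 i2) (fun r => r ^+ 2));
      [exact: coord_cts|exact: exprn_continuous].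
- by move=> x _; exact: coord_cts.
- by move=> x _; exact: coord_cts.
Qed.

Lemma cylinder_coord (x : 'rV[R]_3) (j : 'I_3) : cylinder x -> `|x 0 j| <= 1.
Proof.
rewrite /cylinder /= radius_le1 => -[h1 /andP[h2 h3]].
case: j => [[|[|[|//]]] Hj].
- rewrite (_ : Ordinal Hj = i1); last exact/val_inj.
  by rewrite -(@ler_sqr _ _ 1) ?nnegrE// expr1n real_normK ?num_real//; nra.
- rewrite (_ : Ordinal Hj = i2); last exact/val_inj.
  by rewrite -(@ler_sqr _ _ 1) ?nnegrE// expr1n real_normK ?num_real//; nra.
- by rewrite (_ : Ordinal Hj = i3); [rewrite ger0_norm|exact/val_inj].
Qed.

Lemma compact_cylinder : compact (@cylinder R).
Proof.
apply: bounded_closed_compact; last exact: closed_cylinder.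
exists 1; split => // M M1 x Dx /=.
rewrite [leLHS]/Num.Def.normr/= mx_normrE bigmax_le ?(le_trans ler01 (ltW M1))//.
by move=> [i j] _ /=; rewrite ord1 (le_trans (cylinder_coord _ Dx)) ?ltW.
Qed.

Definition slab (I : set R) : set (spacetime R) := @cylinder R `*` I.

Lemma slab_bounded I (h : spacetime R -> R) : compact I ->
  (forall z, slab I z -> {for z, continuous h}) ->
  exists M, 0 <= M /\ forall z, slab I z -> `|h z| <= M.
Proof.
move=> cI ch.
have Ks : compact (slab I) by apply: compact_setX => //; exact: compact_cylinder.
have /compact_bounded [M [_ HM]] : compact (h @` slab I).
  by apply: continuous_compact => //; apply: continuous_in_subspaceT => z /set_mem; exact: ch.
exists (`|M| + 1); split; first by rewrite addr_ge0.
move=> z Kz; apply: (HM (`|M| + 1)) => /=; last by exists z.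
by rewrite ltr_pwDr// ler_norm.
Qed.

Local Notation slabm I := [set z : triple R * measurableTypeR R | slab I (event z.1 z.2)].

Lemma measurable_slab (I : set (measurableTypeR R)) : measurable I -> measurable (slabm I).
Proof.
move=> mI; rewrite (_ : slabm I = D3 `*` I)//.
by apply: measurableX => //; exact: measurable_D3.
Qed.

Lemma lebesgue3_D3 : (@lebesgue_measure3 R D3 < +oo)%E.
Proof.
have sD : D3 `<=` (`[-1, 1]%classic `*` `[-1, 1]%classic) `*` `[0, 1]%classic.
  move=> y Dy; have /D3P[_ y3] := Dy.
  have := cylinder_coord i1 Dy; have := cylinder_coord i2 Dy.
  by rewrite !point3E !ler_norml => h2 h1; rewrite /= !in_itv/=.
have mB : measurable ((`[-1, 1]%classic `*` `[-1, 1]%classic) `*` `[0, 1]%classic : set (triple R)).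
  by apply: measurableX => //; exact: measurableX.
apply: le_lt_trans; first by apply: (le_measure _ _ _ sD); rewrite inE//; exact: measurable_D3.
have finM (x y : \bar R) : (0 <= x -> 0 <= y -> x < +oo -> y < +oo -> x * y < +oo)%E.
  by move=> x0 y0 xoo yoo; rewrite lte_mul_pinfty// ge0_fin_numE.
rewrite /lebesgue_measure3 /= product_measure1E//; last exact: measurableX.
rewrite [X in (X * _)%E]product_measure1E//.
by apply: (finM _ _); [exact: mule_ge0|exact: measure_ge0|apply: (finM _ _); [exact: measure_ge0|exact: measure_ge0|exact: lebesgue_itv_lty|exact: lebesgue_itv_lty]|exact: lebesgue_itv_lty].
Qed.

Definition box3 (y : R * R * R) (e : R) : set (triple R) :=
  (`]y.1.1 - e, y.1.1 + e[%classic `*` `]y.1.2 - e, y.1.2 + e[%classic)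
    `*` `]y.2 - e, y.2 + e[%classic.

Lemma lebesgue3_box3 (y : R * R * R) (e : R) : 0 < e ->
  (0 < @lebesgue_measure3 R (box3 y e))%E.
Proof.
move=> e0.
have pos (a : R) : (0 < mu (`](a - e)%R, (a + e)%R[%classic : set R))%E.
  have ae : a - e < a + e by rewrite ltrBlDr -addrA ltrDl addr_gt0.
  by rewrite lebesgue_measure_itv/= lte_fin ae -EFinB lte_fin subr_gt0.
rewrite /lebesgue_measure3 /box3/= product_measure1E//; last exact: measurableX.
rewrite [X in (X * _)%E]product_measure1E//.
by apply: mule_gt0; [apply: mule_gt0; exact: pos|exact: pos].
Qed.

End Slab.

(** * Calculus along lines *)

Section Lines.
Variable R : realType.
Local Notation mu := (@lebesgue_measure R).

Lemma integral_derive (F f : R -> R) (a b : R) : a <= b ->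
  (forall x, a <= x <= b -> is_derive x 1 F (f x)) ->
  (forall x, a <= x <= b -> {for x, continuous f}) ->
  (\int[mu]_(x in `[a, b]) (f x)%:E = (F b - F a)%:E)%E.
Proof.
rewrite le_eqVlt => /predU1P[->|ab] dF cf.
  by rewrite set_itv1 integral_set1 subrr.
have cF x : a <= x <= b -> {for x, continuous F}.
  move=> xab; have [dFx _] := dF _ xab.
  exact/differentiable_continuous/derivable1_diffP.
rewrite EFinB; apply: continuous_FTC2 => //.
- by apply: continuous_in_subspaceT => x; rewrite inE/= in_itv/=; exact: cf.
- split.
  + by move=> x; rewrite in_itv/= => /andP[/ltW ax /ltW xb]; have [] := dF x; rewrite ?ax ?xb.
  + by apply: cvg_at_right_filter; apply: cF; rewrite lexx ltW.
  + by apply: cvg_at_left_filter; apply: cF; rewrite lexx ltW.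
- move=> x; rewrite in_itv/= => /andP[/ltW ax /ltW xb].
  by rewrite derive1E; have [|_ ->] := dF x; rewrite ?ax ?xb.
Qed.

(** A curve [c] that is affine with velocity [v] turns a directional derivative
    along [v] into a derivative in one variable, and conversely; this transfers
    the fundamental theorem of calculus and the chain rule to directional
    derivatives. *)
Section line.
Variables (V : normedModType R) (c : R -> V) (v : V).
Hypothesis lc : forall s h, c (s + h) = h *: v + c s.

Lemma line_continuous : continuous c.
Proof.
rewrite (_ : c = fun s => s *: v + c 0); last by apply/funext => s; rewrite -lc add0r.
by move=> s; apply: cvgD; [exact: scalel_continuous|exact: cvg_cst].
Qed.

Lemma line_is_derive (W : normedModType R) (F : V -> W) (s : R) (l : W) :
  is_derive (c s) v F l -> is_derive s 1 (F \o c) l.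
Proof.
have E : (fun h : R => h^-1 *: (((F \o c) \o shift s) (h *: 1) - (F \o c) s)) =
   (fun h : R => h^-1 *: ((F \o shift (c s)) (h *: v) - F (c s))).
  by apply/funext => h /=; rewrite /shift/= [_%:A]mulr1 [h + s]addrC lc.
move=> [dF Fl]; split; first by rewrite /derivable E.
by rewrite /derive E.
Qed.

Lemma is_derive_line (W : normedModType R) (F : V -> W) (s : R) (l : W) :
  is_derive s 1 (F \o c) l -> is_derive (c s) v F l.
Proof.
have E : (fun h : R => h^-1 *: (((F \o c) \o shift s) (h *: 1) - (F \o c) s)) =
   (fun h : R => h^-1 *: ((F \o shift (c s)) (h *: v) - F (c s))).
  by apply/funext => h /=; rewrite /shift/= [_%:A]mulr1 [h + s]addrC lc.
move=> [dF Fl]; split; first by rewrite /derivable -E.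
by rewrite /derive -E.
Qed.

Lemma line_integral (F F' : V -> R) (a b : R) : a <= b ->
  (forall s, a <= s <= b -> is_derive (c s) v F (F' (c s))) ->
  (forall s, a <= s <= b -> {for (c s), continuous F'}) ->
  (\int[mu]_(s in `[a, b]) (F' (c s))%:E = (F (c b) - F (c a))%:E)%E.
Proof.
move=> ab dF cF'.
apply: (@integral_derive (F \o c) (F' \o c)) => //.
  by move=> s sab; apply: line_is_derive; exact: dF.
move=> s sab; apply: continuous_comp; first exact: line_continuous.
exact: cF'.
Qed.

End line.

Section chain.
Variables (V : normedModType R) (z v : V).

Let segment (s : R) : V := s *: v + z.

Let segmentD s h : segment (s + h) = h *: v + segment s.
Proof. by rewrite /segment scalerDl addrA [h *: v + _]addrC. Qed.

Let segment0 : segment 0 = z. Proof. by rewrite /segment scale0r add0r. Qed.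

Lemma is_derive_affine (f : V -> R) (l : R) :
  (forall h : R, f (h *: v + z) = f z + h * l) -> is_derive z v f l.
Proof.
move=> fh; rewrite -segment0; apply: (is_derive_line segmentD (s := 0)).
rewrite (_ : f \o segment = fun s => f z + s * l); last exact/funext.
by apply: is_derive_eq; rewrite add0r mul1r scaler0 add0r [_%:A]mulr1.
Qed.

Lemma is_derive_chain (g : R -> R) (f : V -> R) (a b : R) :
  is_derive (f z) 1 g a -> is_derive z v f b -> is_derive z v (g \o f) (a * b).
Proof.
move=> dg; rewrite -segment0 => df; apply: (is_derive_line segmentD (s := 0)).
apply: (@is_derive1_comp R g (f \o segment)); first by rewrite /= segment0.
exact: (line_is_derive segmentD).
Qed.

End chain.

Lemma integrable_bounded d (X : measurableType d) (m : {measure set X -> \bar R})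
    (A : set X) (g : X -> \bar R) (M : R) :
  measurable A -> (m A < +oo)%E -> measurable_fun setT g ->
  (forall x, A x -> (`|g x| <= M%:E)%E) -> (forall x, ~ A x -> g x = 0%E) ->
  m.-integrable setT g.
Proof.
move=> mA Aoo mg gM g0; apply/integrableP; split => //.
have -> : (fun x => `|g x|)%E = (fun x => `|g x|)%E \_ A.
  apply/funext => x; rewrite patchE; case: ifPn => // /negP xA.
  by rewrite g0 ?abse0// => Ax; apply: xA; rewrite inE.
rewrite -integral_mkcond.
have MM : (M <= `|M| + 1)%R by rewrite (le_trans (ler_norm _))// lerDl.
apply: (@le_lt_trans _ _ ((`|M| + 1)%:E * m A)%E); last by rewrite lte_mul_pinfty.
apply: integral_le_bound => //.
- exact: measurable_funTS.
- by apply: aeW => x Ax; rewrite (le_trans (gM _ Ax)).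
Qed.

End Lines.

(** * The divergence theorem on the cylinder *)

Section Slices.
Context d1 d2 (T1 : measurableType d1) (T2 : measurableType d2) (R : realType).
Variables (m1 : {sigma_finite_measure set T1 -> \bar R})
          (m2 : {sigma_finite_measure set T2 -> \bar R}).

Lemma sigma_finite_prod : sigma_finite setT (m1 \x m2)%E.
Proof.
have /sigma_finiteP[F [TF ndF Foo]] := sigma_finiteT m1.
have /sigma_finiteP[G [TG ndG Goo]] := sigma_finiteT m2.
exists (fun n => F n `*` G n).
  rewrite -setXTT TF TG; apply/seteqP; split => [[x y] [/= [n _ Fx] [m _ Gy]]|[x y] [n _ []]].
    exists (maxn n m) => //; split => /=.
    - by move: Fx; apply/subsetPset/ndF; exact: leq_maxl.
    - by move: Gy; apply/subsetPset/ndG; exact: leq_maxr.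
  by move=> Fx Gy; split; exists n.
move=> n; have [mF Fn] := Foo n; have [mG Gn] := Goo n.
split; first exact: measurableX.
by rewrite product_measure1E// lte_mul_pinfty// ge0_fin_numE.
Qed.

Variable f : T1 * T2 -> \bar R.
Hypothesis intf : (m1 \x m2)%E.-integrable setT f.

Lemma integral_prod_slice1 :
  (forall y, (\int[m1]_x f (x, y) = 0)%E) -> (\int[m1 \x m2]_z f z = 0)%E.
Proof. by move=> H; rewrite -integral21_prod_meas1//; apply: integral0_eq => y _; exact: H. Qed.

Lemma integral_prod_slice2 :
  (forall x, (\int[m2]_y f (x, y) = 0)%E) -> (\int[m1 \x m2]_z f z = 0)%E.
Proof. by move=> H; rewrite -integral12_prod_meas1//; apply: integral0_eq => x _; exact: H. Qed.

End Slices.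

Section Divergence.
Variable R : realType.
Local Notation mu := (@lebesgue_measure R).

(** Lebesgue measure of the plane and of space are named in order to carry the
    sigma-finite structure that Fubini asks of both factors of a product. *)
Definition lebesgue2 := (mu \x mu)%E.

HB.instance Definition _ := Measure.on lebesgue2.

HB.instance Definition _ := Measure_isSigmaFinite.Build _ _ _ lebesgue2
  (sigma_finite_prod mu mu).

Definition lebesgue3 := (lebesgue2 \x mu)%E.

HB.instance Definition _ := Measure.on lebesgue3.

HB.instance Definition _ := Measure_isSigmaFinite.Build _ _ _ lebesgue3
  (sigma_finite_prod lebesgue2 mu).

Local Notation mu3 := lebesgue3.

Section slice.
Variables (t : R) (h : spacetime R -> R).
Hypothesis ch : forall x, cylinder x -> {for (x, t), continuous h}.

Definition on_D3 (y : triple R) : \bar R := ((EFin \o (fun y => h (event y t))) \_ (@D3 R)) y.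

Lemma measurable_on_D3 : measurable_fun setT on_D3.
Proof.
apply: (measurable_restrictT _ _).1; first exact: measurable_D3.
apply/measurable_EFinP.
have mt : measurable ([set t] : set (measurableTypeR R)) by exact: measurable_set1.
have mh := @continuous_measurable_event R (slab [set t]) h (measurable_slab mt).
have -> : (fun y => h (event y t)) =
    (fun z : triple R * measurableTypeR R => h (event z.1 z.2)) \o pair^~ t by [].
apply: (measurable_comp (measurable_slab mt)).
- by move=> _ [y Dy <-].
- by apply: mh => -[x s] [/= Dx ->]; exact: ch.
- exact: measurable_funTS.
Qed.

Lemma on_D3_bounded : exists M : R, 0 <= M /\ forall y, (`|on_D3 y| <= M%:E)%E.
Proof.
have [|z [Dz zt]|M [M0 HM]] := @slab_bounded R [set t] h.
- exact: compact_set1.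
- by case: z Dz zt => x s /= Dx ->; exact: ch.
exists M; split => // y; rewrite /on_D3 patchE; case: ifPn => [/set_mem Dy|_].
  by rewrite lee_fin HM.
by rewrite abse0 lee_fin.
Qed.

Lemma on_D3_out y : ~ D3 y -> on_D3 y = 0%E.
Proof. by move=> Dy; rewrite /on_D3 patchE; case: ifPn => // /set_mem. Qed.

Lemma on_D3_in y : D3 y -> on_D3 y = (h (event y t))%:E.
Proof. by move=> Dy; rewrite /on_D3 patchE mem_set. Qed.

Lemma integrable_on_D3 : mu3.-integrable setT on_D3.
Proof.
have [M [M0 HM]] := on_D3_bounded.
apply: (@integrable_bounded _ _ _ _ (@D3 R) _ M) => //.
- exact: measurable_D3.
- exact: lebesgue3_D3.
- exact: measurable_on_D3.
- exact: on_D3_out.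
Qed.

Lemma integrable_on_D3_slice (x3 : R) :
  lebesgue2.-integrable setT (fun p : measurableTypeR R * measurableTypeR R => on_D3 (p, x3)).
Proof.
have [M [M0 HM]] := on_D3_bounded.
pose Q : set (measurableTypeR R * measurableTypeR R) :=
  `[-1, 1]%classic `*` `[-1, 1]%classic.
apply: (@integrable_bounded _ _ _ _ Q _ M) => //.
- exact: measurableX.
- rewrite /Q /= /lebesgue2 product_measure1E//.
  by rewrite lte_mul_pinfty// ?ge0_fin_numE//; exact: lebesgue_itv_lty.
- exact: (measurableT_comp measurable_on_D3).
- move=> [x1 x2] H; apply: on_D3_out => Dy; apply: H.
  have := cylinder_coord i1 Dy; have := cylinder_coord i2 Dy.
  by rewrite !point3E !ler_norml => h2 h1; rewrite /Q /= !in_itv/=.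
Qed.

(** By Fubini, an integral over the cylinder vanishes when the integrals along
    all the lines of one coordinate direction do; the three directions differ in
    the order in which the coordinates are integrated. *)
Lemma integral_D3_slice1 :
  (forall x2 x3, (\int[mu]_x1 on_D3 (x1, x2, x3) = 0)%E) ->
  (\int[mu3]_y on_D3 y = 0)%E.
Proof.
move=> H; apply: (integral_prod_slice1 integrable_on_D3) => x3.
by apply: (integral_prod_slice1 (integrable_on_D3_slice x3)) => x2; exact: H.
Qed.

Lemma integral_D3_slice2 :
  (forall x1 x3, (\int[mu]_x2 on_D3 (x1, x2, x3) = 0)%E) ->
  (\int[mu3]_y on_D3 y = 0)%E.
Proof.
move=> H; apply: (integral_prod_slice1 integrable_on_D3) => x3.
by apply: (integral_prod_slice2 (integrable_on_D3_slice x3)) => x1; exact: H.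
Qed.

Lemma integral_D3_slice3 :
  (forall x1 x2, (\int[mu]_x3 on_D3 (x1, x2, x3) = 0)%E) ->
  (\int[mu3]_y on_D3 y = 0)%E.
Proof.
move=> H; apply: (integral_prod_slice2 integrable_on_D3) => -[x1 x2].
exact: H.
Qed.

End slice.
End Divergence.

Section DivergenceTheorem.
Variable R : realType.
Local Notation mu := (@lebesgue_measure R).
Local Notation mu3 := (@lebesgue3 R).

Lemma event_line1 (x2 x3 t s h : R) :
  event (s + h, x2, x3) t = h *: dir R (Some i1) + event (s, x2, x3) t.
Proof.
rewrite /event /dir; congr pair; last by rewrite /= scaler0 add0r.
by rewrite /point3/= scalerDl !addrA [h *: _ + _]addrC.
Qed.

Lemma event_line2 (x1 x3 t s h : R) :
  event (x1, s + h, x3) t = h *: dir R (Some i2) + event (x1, s, x3) t.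
Proof.
rewrite /event /dir; congr pair; last by rewrite /= scaler0 add0r.
by rewrite /point3/= scalerDl !addrA; congr (_ + _); rewrite -[RHS]addrA [RHS]addrC.
Qed.

Lemma event_line3 (x1 x2 t s h : R) :
  event (x1, x2, s + h) t = h *: dir R (Some i3) + event (x1, x2, s) t.
Proof.
rewrite /event /dir; congr pair; last by rewrite /= scaler0 add0r.
by rewrite /point3/= scalerDl addrA [RHS]addrC.
Qed.

Lemma event_lineT (y : triple R) (s h : R) :
  event y (s + h) = h *: dir R None + event y s.
Proof.
rewrite /event /dir; congr pair; first by rewrite /= scaler0 add0r.
by rewrite /= [h *: _]mulr1 addrC.
Qed.

Section flux.
Variables (t : R) (F F' : spacetime R -> R) (j : 'I_3).
Hypothesis dF : forall x, cylinder x -> is_derive (x, t) (dir R (Some j)) F (F' (x, t)).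
Hypothesis cF' : forall x, cylinder x -> {for (x, t), continuous F'}.

Let line_slice (c : R -> triple R) (a b : R) : a <= b ->
  (forall s h, event (c (s + h)) t = h *: dir R (Some j) + event (c s) t) ->
  (forall s, D3 (c s) <-> a <= s <= b) ->
  F (event (c a) t) = 0 -> F (event (c b) t) = 0 ->
  (\int[mu]_s on_D3 t F' (c s) = 0)%E.
Proof.
move=> ab lc Dc Fa Fb.
have -> : (fun s => on_D3 t F' (c s)) = (fun s => (F' (event (c s) t))%:E) \_ `[a, b].
  apply/funext => s; rewrite patchE; case: ifPn => [|/negP sab].
    by rewrite inE/= in_itv/= => /Dc; exact: on_D3_in.
  by apply: on_D3_out => /Dc sab'; apply: sab; rewrite inE/= in_itv.
rewrite -integral_mkcond.
have dFc s : a <= s <= b -> is_derive (event (c s) t) (dir R (Some j)) F (F' (event (c s) t)).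
  by move=> /Dc; exact: dF.
rewrite (@line_integral R _ (fun s => event (c s) t) _ lc F F' a b ab dFc) ?Fa ?Fb ?subrr//.
by move=> s /Dc; exact: cF'.
Qed.

Let empty_slice (c : R -> triple R) : (forall s, ~ D3 (c s)) ->
  (\int[mu]_s on_D3 t F' (c s) = 0)%E.
Proof. by move=> Dc; rewrite integral0_eq// => s _; exact: on_D3_out. Qed.

(** Along a line the derivative integrates to the difference of the boundary
    values, which are zero, and Fubini assembles the lines. *)
Lemma integral_lateral : (j = i1 \/ j = i2) ->
  (forall x, vertical_boundary x -> F (x, t) = 0) ->
  (\int[mu3]_y on_D3 t F' y = 0)%E.
Proof.
have sq (a b : R) : a ^+ 2 <= 1 -> (b ^+ 2 + a ^+ 2 <= 1) =
    (- Num.sqrt (1 - a ^+ 2) <= b <= Num.sqrt (1 - a ^+ 2)).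
  move=> a1; rewrite -ler_norml -lerBrDr.
  by rewrite -(@ler_sqr _ `|b|) ?nnegrE ?sqrtr_ge0// real_normK ?num_real// sqr_sqrtr// subr_ge0.
have rt (a : R) : a ^+ 2 <= 1 -> Num.sqrt (1 - a ^+ 2) ^+ 2 + a ^+ 2 = 1.
  by move=> a1; rewrite sqr_sqrtr ?subr_ge0// subrK.
move=> jE bF; case: jE => jE.
- apply: integral_D3_slice1; first exact: cF'.
  move=> x2 x3.
  have [/andP[x21 x31]|] := boolP ((x2 ^+ 2 <= 1) && (0 <= x3 <= 1)); last first.
    move=> H; apply: (empty_slice (c := fun s => (s, x2, x3))) => s /D3P/= [h1 h2].
    by move/negP: H; apply; rewrite h2 andbT (le_trans _ h1)// lerDr sqr_ge0.
  apply: (line_slice (c := fun s => (s, x2, x3)) (a := - Num.sqrt (1 - x2 ^+ 2))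
    (b := Num.sqrt (1 - x2 ^+ 2))).
  + by rewrite ge0_cp ?sqrtr_ge0.
  + by move=> s h; rewrite jE; exact: event_line1.
  + by move=> s; rewrite D3P/= sq//; split => [[]|].
  + by apply: bF; split; rewrite /Defs.radius !point3E/= ?sqrrN ?rt ?sqrtr1.
  + by apply: bF; split; rewrite /Defs.radius !point3E/= ?rt ?sqrtr1.
- apply: integral_D3_slice2; first exact: cF'.
  move=> x1 x3.
  have [/andP[x11 x31]|] := boolP ((x1 ^+ 2 <= 1) && (0 <= x3 <= 1)); last first.
    move=> H; apply: (empty_slice (c := fun s => (x1, s, x3))) => s /D3P/= [h1 h2].
    by move/negP: H; apply; rewrite h2 andbT (le_trans _ h1)// lerDl sqr_ge0.
  apply: (line_slice (c := fun s => (x1, s, x3)) (a := - Num.sqrt (1 - x1 ^+ 2))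
    (b := Num.sqrt (1 - x1 ^+ 2))).
  + by rewrite ge0_cp ?sqrtr_ge0.
  + by move=> s h; rewrite jE; exact: event_line2.
  + by move=> s; rewrite D3P/= addrC sq//; split => [[]|].
  + by apply: bF; split; rewrite /Defs.radius !point3E/= ?sqrrN 1?addrC ?rt ?sqrtr1.
  + by apply: bF; split; rewrite /Defs.radius !point3E/= 1?addrC ?rt ?sqrtr1.
Qed.

(** In the vertical direction every line that meets the cylinder runs from the
    bottom to the top face. *)
Lemma integral_horizontal : j = i3 ->
  (forall x, horizontal_boundary x -> F (x, t) = 0) ->
  (\int[mu3]_y on_D3 t F' y = 0)%E.
Proof.
move=> jE bF; apply: integral_D3_slice3; first exact: cF'.
move=> x1 x2; have [H|H] := boolP (x1 ^+ 2 + x2 ^+ 2 <= 1); last first.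
  by apply: (empty_slice (c := fun s => (x1, x2, s))) => s /D3P/= [h1 h2]; rewrite h1 in H.
apply: (line_slice (c := fun s => (x1, x2, s)) ler01).
- by move=> s h; rewrite jE; exact: event_line3.
- by move=> s; rewrite D3P/=; split => [[]|].
- by apply: bF; split; rewrite ?radius_le1 !point3E//; left.
- by apply: bF; split; rewrite ?radius_le1 !point3E//; right.
Qed.

End flux.
End DivergenceTheorem.

(** * The energy principle *)

Section Energy.
Variable R : realType.
Local Notation mu := (@lebesgue_measure R).
Local Notation mu3 := (@lebesgue3 R).

(** The cylinder is convex with nonempty interior: moving from a point of it
    towards the centre leaves room for a box, so neighbourhoods of its points,
    even boundary ones, meet it in positive volume. *)
Lemma cylinder_box (x0 : 'rV[R]_3) (O : set 'rV[R]_3) : cylinder x0 -> nbhs x0 O ->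
  exists (p : R * R * R) (r : R), 0 < r /\
    (forall y, box3 p r y -> D3 y /\ O (point3 y)).
Proof.
move=> Dx0; rewrite -nbhs_ballE => -[e /= e0 He].
have x01 := cylinder_coord i1 Dx0; have x02 := cylinder_coord i2 Dx0.
move: (Dx0) => [+ /andP[x03 x03']]; rewrite radius_le1 => x0r.
set a1 := x0 0 i1 in x01 x0r *; set a2 := x0 0 i2 in x02 x0r *; set a3 := x0 0 i3 in x03 x03' *.
(* [s] is the fraction of the way to the centre (0, 0, 1 / 2), and the box has
   half-width s / 8: a first-order move inwards outweighs the box. *)
pose s := Num.min (2^-1) (e / 4).
have s0 : 0 < s by rewrite lt_min invr_gt0 ltr0n divr_gt0.
have s1 : s <= 2^-1 by rewrite ge_min lexx.
have se : s <= e / 4 by rewrite ge_min lexx orbT.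
exists ((1 - s) * a1, (1 - s) * a2, (1 - s) * a3 + s / 2), (s / 8).
split; first by rewrite divr_gt0.
move: x01 x02; rewrite !ler_norml => /andP[b1 b1'] /andP[b2 b2'].
case=> -[y1 y2] y3 [[]]; rewrite /= !in_itv/= => /andP[l1 u1] /andP[l2 u2] /andP[l3 u3].
have ds : e / 4 + e / 4 < e by lra.
split.
  apply/D3P => /=; split; last by apply/andP; split; nra.
  pose d1 := y1 - (1 - s) * a1; pose d2 := y2 - (1 - s) * a2.
  have q1 : d1 * a1 <= s / 8.
    have [h|h] := leP 0 a1; first by rewrite /d1; nra.
    by rewrite /d1; nra.
  have q2 : d2 * a2 <= s / 8.
    have [h|h] := leP 0 a2; first by rewrite /d2; nra.
    by rewrite /d2; nra.
  have r1 : d1 ^+ 2 <= (s / 8) ^+ 2 by rewrite /d1; nra.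
  have r2 : d2 ^+ 2 <= (s / 8) ^+ 2 by rewrite /d2; nra.
  have -> : y1 = d1 + (1 - s) * a1 by rewrite subrK.
  have -> : y2 = d2 + (1 - s) * a2 by rewrite subrK.
  have -> : (d1 + (1 - s) * a1) ^+ 2 + (d2 + (1 - s) * a2) ^+ 2 =
    d1 ^+ 2 + d2 ^+ 2 + 2 * (1 - s) * (d1 * a1 + d2 * a2) + (1 - s) ^+ 2 * (a1 ^+ 2 + a2 ^+ 2) by ring.
  have h1 : (1 - s) ^+ 2 * (a1 ^+ 2 + a2 ^+ 2) <= (1 - s) ^+ 2 by rewrite ler_piMr// sqr_ge0.
  have h2 : 2 * (1 - s) * (d1 * a1 + d2 * a2) <= 2 * (1 - s) * (s / 8 + s / 8).
    by rewrite ler_wpM2l ?lerD// mulr_ge0//; lra.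
  by nra.
apply: He; split => // i j; rewrite ord1 -ball_normE/=.
case: j => [[|[|[|//]]] Hj].
- rewrite (_ : Ordinal Hj = i1) ?point3E/=; last exact/val_inj.
  by rewrite -/a1 ltr_distlC; apply/andP; split; nra.
- rewrite (_ : Ordinal Hj = i2) ?point3E/=; last exact/val_inj.
  by rewrite -/a2 ltr_distlC; apply/andP; split; nra.
- rewrite (_ : Ordinal Hj = i3) ?point3E/=; last exact/val_inj.
  by rewrite -/a3 ltr_distlC; apply/andP; split; nra.
Qed.

(** A nonnegative function with nonpositive integral vanishes at its points of
    continuity: otherwise it is bounded below on a box of positive volume. *)
Lemma integral_on_D3_eq0 (t : R) (h : spacetime R -> R) :
  (forall x, cylinder x -> {for (x, t), continuous h}) ->
  (forall x, cylinder x -> 0 <= h (x, t)) ->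
  (\int[mu3]_y on_D3 t h y <= 0)%E -> forall x, cylinder x -> h (x, t) = 0.
Proof.
move=> ch h0 Ih x0 Dx0; apply/eqP; rewrite eq_le h0// andbT leNgt; apply/negP => hx0.
pose a := h (x0, t) / 2.
have a0 : 0 < a by rewrite divr_gt0.
have cht : (fun x => h (x, t)) @ x0 --> h (x0, t).
  apply: (@continuous_comp _ _ _ (fun x => (x, t)) h); last exact: ch.
  exact: (@cvg_pair _ _ _ (nbhs x0) (nbhs x0) (nbhs t) _ _ _ id (fun=> t) cvg_id (cvg_cst t)).
have nO : nbhs x0 [set x | a < h (x, t)].
  by apply: (cvgr_gt _ cht); rewrite /a; lra.
have [p [r [r0 Hb]]] := cylinder_box Dx0 nO.
have g0 y : (0 <= on_D3 t h y)%E.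
  rewrite /on_D3 patchE; case: ifPn => // /set_mem Dy.
  by rewrite /= lee_fin h0.
have mb : measurable (box3 p r) by apply: measurableX => //; exact: measurableX.
have : (a%:E * mu3 (box3 p r) <= \int[mu3]_y on_D3 t h y)%E.
  rewrite -integral_cst//.
  apply: (@le_trans _ _ (\int[mu3]_(y in box3 p r) on_D3 t h y)%E).
    apply: ge0_le_integral => //.
    - by move=> y _; rewrite lee_fin ltW.
    - exact: measurable_funTS (measurable_on_D3 ch).
    - by move=> y /Hb[Dy Oy]; rewrite on_D3_in// lee_fin ltW.
  apply: ge0_subset_integral => //; exact: measurable_on_D3.
apply/negP; rewrite -ltNge (le_lt_trans Ih)// mule_gt0//.
exact: (@lebesgue3_box3 R p r r0).
Qed.
End Energy.

Section Comparison.
Variable R : realType.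
Local Notation mu := (@lebesgue_measure R).
Local Notation mu3 := (@lebesgue3 R).

Lemma measurable_slab_fun (I : set (measurableTypeR R)) (h : spacetime R -> R) :
  measurable I -> (forall z, slab I z -> {for z, continuous h}) ->
  measurable_fun setT ((EFin \o (fun z : triple R * measurableTypeR R => h (event z.1 z.2)))
    \_ [set z : triple R * measurableTypeR R | slab I (event z.1 z.2)]).
Proof.
move=> mI ch; apply: (measurable_restrictT _ _).1; first exact: measurable_slab.
apply/measurable_EFinP; apply: continuous_measurable_event => //.
exact: measurable_slab.
Qed.

(** Fubini in space-time for the derivative along time of a function that
    vanishes initially. *)
Lemma integral_time_derivative (psi psi' : spacetime R -> R) (t1 : R) : 0 <= t1 ->
  (forall x t, cylinder x -> 0 <= t <= t1 ->
    is_derive (x, t) (dir R None) psi (psi' (x, t))) ->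
  (forall x t, cylinder x -> 0 <= t <= t1 -> {for (x, t), continuous psi'}) ->
  (forall x, cylinder x -> psi (x, 0) = 0) ->
  (\int[mu3]_y on_D3 t1 psi y = \int[mu]_(t in `[0%R, t1]) \int[mu3]_y on_D3 t psi' y)%E.
Proof.
move=> t10 dpsi cpsi' psi0.
pose S := [set z : triple R * measurableTypeR R | slab `[0, t1]%classic (event z.1 z.2)].
pose H := (EFin \o (fun z : triple R * measurableTypeR R => psi' (event z.1 z.2))) \_ S.
have cS z : slab `[0, t1]%classic z -> {for z, continuous psi'}.
  by case: z => x t [Dx]; rewrite /= in_itv/=; exact: cpsi'.
have mH : measurable_fun setT H by exact: measurable_slab_fun.
have [M [M0 HM]] := slab_bounded (@segment_compact _ 0 t1) cS.
have iH : (mu3 \x mu)%E.-integrable setT H.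
  apply: (@integrable_bounded _ _ _ _ S _ M) => //.
  - exact: measurable_slab.
  - rewrite (_ : S = @D3 R `*` `[0, t1]%classic)//=.
    rewrite product_measure1E//; last exact: measurable_D3.
    by rewrite lte_mul_pinfty// ?ge0_fin_numE//; [exact: lebesgue3_D3|exact: lebesgue_itv_lty].
  - by move=> z Sz; rewrite /H patchE mem_set//= lee_fin HM.
  - by move=> z Sz; rewrite /H patchE memNset.
transitivity (\int[mu3]_y \int[mu]_t H (y, t))%E.
  apply: eq_integral => y _.
  have [Dy|Dy] := pselect (D3 y); last first.
    rewrite on_D3_out// integral0_eq// => t _.
    by rewrite /H patchE memNset// => -[].
  rewrite on_D3_in//.
  have -> : (fun t => H (y, t)) = (fun t => (psi' (event y t))%:E) \_ `[0, t1].
    apply/funext => t; rewrite /H !patchE; case: ifPn => [/set_mem[_ tI]|tI].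
      by rewrite mem_set.
    by rewrite memNset// => t01; move/negP: tI; apply; rewrite inE.
  rewrite -integral_mkcond.
  have d t : 0 <= t <= t1 -> is_derive (event y t) (dir R None) psi (psi' (event y t)).
    exact: dpsi.
  rewrite (@line_integral R _ (event y) _ (event_lineT y) psi psi' 0 t1 t10 d).
    by rewrite [in RHS]/event (psi0 _ Dy) subr0.
  by move=> t tI; exact: cpsi'.
rewrite (Fubini iH) [RHS]integral_mkcond; apply: eq_integral => t _.
rewrite patchE; case: ifPn => tI.
  apply: eq_integral => y _; rewrite /H /on_D3 !patchE.
  have [Dy|Dy] := pselect (D3 y).
    by rewrite !mem_set//; split => //; move: tI; rewrite inE.
  by rewrite !memNset// => -[].
rewrite integral0_eq// => y _; rewrite /H patchE memNset// => -[_ /= t01].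
by move/negP: tI; apply; rewrite inE.
Qed.

(** A weighted energy argument: after multiplication by the exponential factor
    the time derivative of [phi] is at most a divergence whose flux through the
    boundary vanishes, so the total energy cannot leave zero. *)
Lemma energy_vanishes (t1 lam : R) (phi phi' : spacetime R -> R)
    (F F' : 'I_3 -> spacetime R -> R) : 0 <= t1 ->
  (forall x t, cylinder x -> 0 <= t <= t1 ->
    [/\ is_derive (x, t) (dir R None) phi (phi' (x, t)),
        {for (x, t), continuous phi}, {for (x, t), continuous phi'} & 0 <= phi (x, t)]) ->
  (forall j x t, cylinder x -> 0 <= t <= t1 ->
     is_derive (x, t) (dir R (Some j)) (F j) (F' j (x, t)) /\
     {for (x, t), continuous (F' j)}) ->
  (forall x t, cylinder x -> 0 <= t <= t1 ->
     phi' (x, t) <= F' i1 (x, t) + F' i2 (x, t) + F' i3 (x, t) + lam * phi (x, t)) ->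
  (forall x t, vertical_boundary x -> 0 <= t <= t1 ->
     F i1 (x, t) = 0 /\ F i2 (x, t) = 0) ->
  (forall x t, horizontal_boundary x -> 0 <= t <= t1 -> F i3 (x, t) = 0) ->
  (forall x, cylinder x -> phi (x, 0) = 0) ->
  forall x, cylinder x -> phi (x, t1) = 0.
Proof.
move=> t10 dphi dF le_phi' vF hF phi0 x Dx.
pose k t := expR (- lam * t).
pose psi z := k z.2 * phi z.
pose psi' z := k z.2 * (phi' z - lam * phi z).
have dk (t : R) : is_derive t 1 k (- lam * k t).
  have d0 : is_derive t (1 : R) (fun t : R => - lam * t) (- lam).
    by apply: is_derive_eq; rewrite [_ *: _]mulr1.
  by rewrite mulrC; exact: (is_derive1_comp (is_derive_expR _) d0).
have ck z : {for z, continuous (fun z : spacetime R => k z.2)}.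
  apply: continuous_comp; first exact: cvg_snd.
  by apply: continuous_comp; [exact: mulrl_continuous|exact: continuous_expR].
have dpsi y t : cylinder y -> 0 <= t <= t1 ->
    is_derive (y, t) (dir R None) psi (psi' (y, t)).
  move=> Dy tI; have [d1 _ _ _] := dphi _ _ Dy tI.
  have d2 : is_derive (y, t) (dir R None) (fun z : spacetime R => k z.2) (- lam * k t).
    rewrite -(point3_surj y).
    exact: (@is_derive_line R _ _ _ (event_lineT (y 0 i1, y 0 i2, y 0 i3)) _ (fun z => k z.2) t).
  apply: (is_derive_eq (is_deriveM d2 d1)).
  by rewrite /psi' /= /GRing.scale/=; ring.
have cpsi' y t : cylinder y -> 0 <= t <= t1 -> {for (y, t), continuous psi'}.
  move=> Dy tI; have [_ c1 c2 _] := dphi _ _ Dy tI.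
  apply: cvgM; first exact: ck.
  by apply: cvgB => //; apply: cvgM => //; exact: cvg_cst.
have psi0 y : cylinder y -> psi (y, 0) = 0 by move=> Dy; rewrite /psi phi0// mulr0.
have t1I : 0 <= t1 <= t1 by rewrite t10 lexx.
suff : psi (x, t1) = 0.
  by move/eqP; rewrite /psi mulf_eq0 gt_eqF ?expR_gt0//= => /eqP.
apply: (integral_on_D3_eq0 (h := psi)) => //.
- move=> y Dy; have [_ c1 _ _] := dphi _ _ Dy t1I.
  by apply: cvgM => //; exact: ck.
- move=> y Dy; have [_ _ _ p0] := dphi _ _ Dy t1I.
  by rewrite mulr_ge0// expR_ge0.
rewrite (integral_time_derivative t10 dpsi cpsi' psi0).
have Iflux t : 0 <= t <= t1 -> (\int[mu3]_y on_D3 t psi' y <= 0)%E.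
  move=> tI.
  have cF j y : cylinder y -> {for (y, t), continuous (F' j)}.
    by move=> Dy; have [] := dF j _ _ Dy tI.
  have dFj j y : cylinder y -> is_derive (y, t) (dir R (Some j)) (F j) (F' j (y, t)).
    by move=> Dy; have [] := dF j _ _ Dy tI.
  have J1 : (\int[mu3]_y on_D3 t (F' i1) y = 0)%E.
    apply: (integral_lateral (dFj i1) (cF i1)); first by left.
    by move=> y vy; have [] := vF _ _ vy tI.
  have J2 : (\int[mu3]_y on_D3 t (F' i2) y = 0)%E.
    apply: (integral_lateral (dFj i2) (cF i2)); first by right.
    by move=> y vy; have [] := vF _ _ vy tI.
  have J3 : (\int[mu3]_y on_D3 t (F' i3) y = 0)%E.
    by apply: (integral_horizontal (dFj i3) (cF i3)) => // y hy; exact: hF.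
  have I_ j : mu3.-integrable setT (on_D3 t (F' j)) by apply: integrable_on_D3; exact: cF.
  have I12 : mu3.-integrable setT (fun y => on_D3 t (F' i1) y + on_D3 t (F' i2) y)%E.
    exact: integrableD.
  have I123 : mu3.-integrable setT
      (fun y => on_D3 t (F' i1) y + on_D3 t (F' i2) y + on_D3 t (F' i3) y)%E.
    exact: integrableD.
  apply: (@le_trans _ _ (\int[mu3]_y ((k t)%:E *
      (on_D3 t (F' i1) y + on_D3 t (F' i2) y + on_D3 t (F' i3) y)))%E); last first.
    rewrite integralZl// integralD//.
    by rewrite integralD// J1 J2 J3 !adde0 mule0.
  apply: le_integral => //.
  - apply: integrable_on_D3 => y Dy; exact: cpsi'.
  - exact: integrableZl.
  move=> y _; have [Dy|Dy] := pselect (D3 y); last by rewrite !on_D3_out// !adde0 mule0.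
  rewrite !on_D3_in// -!EFinD -EFinM lee_fin /psi' ler_wpM2l ?expR_ge0//.
  by rewrite lerBlDr; exact: le_phi'.
pose G t : \bar R := (- \int[mu3]_y on_D3 t psi' y)%E.
apply: (@le_trans _ _ (\int[mu]_(t in `[0%R, t1]) - G t)%E).
  by rewrite le_eqVlt (_ : _ == _)//; apply/eqP/eq_integral => t _; rewrite /G oppeK.
rewrite integral_ge0N => [|t]; rewrite ?oppe_le0 ?integral_ge0//=.
  by move=> t; rewrite /= in_itv/= => tI; rewrite oppe_ge0 Iflux.
by rewrite in_itv/= => tI; rewrite oppe_ge0 Iflux.
Qed.
End Comparison.

(** * Uniqueness of smooth solutions *)

Section Smooth.
Variable R : realType.

Lemma smooth_onW (W : normedModType R) (A : set (spacetime R)) (u : spacetime R -> W)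
    (s : seq (option 'I_3)) z : smooth_on A u -> A z ->
  {for z, continuous (iter_partial s u)} /\
  (forall d, derivable (iter_partial s u) z (dir R d)).
Proof. by move=> [U [_ AU]] + /AU; apply. Qed.

Lemma is_derive_coord (u : spacetime R -> 'rV[R]_3) z v i :
  derivable u z v -> is_derive z v (fun z => u z 0 i) (('D_v u z) 0 i).
Proof.
move=> du; apply: DeriveDef; first by move: du => /derivable_mxP; apply.
by rewrite derive_mx// mxE.
Qed.

Lemma continuous_coord (u : spacetime R -> 'rV[R]_3) z i :
  {for z, continuous u} -> {for z, continuous (fun z => u z 0 i)}.
Proof.
by move=> cu; exact: (@continuous_comp _ _ _ u (fun x => x 0 i) z cu (@coord_cts R i _)).
Qed.

Lemma is_derive_invariant (f : spacetime R -> R) z v :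
  (forall h : R, f (h *: v + z) = f z) -> is_derive z v f 0.
Proof.
by move=> fh; apply: is_derive_affine => h; rewrite fh mulr0 addr0.
Qed.

Lemma sum3 (V : nmodType) (E : 'I_3 -> V) : \sum_(j < 3) E j = E i1 + E i2 + E i3.
Proof.
rewrite !big_ord_recl big_ord0 addr0 addrA; do !congr (_ + _); congr E; exact/val_inj.
Qed.

Lemma ord3P (i : 'I_3) : [\/ i = i1, i = i2 | i = i3].
Proof.
by case: i => -[|[|[|//]]] Hi; [apply: Or31|apply: Or32|apply: Or33]; exact/val_inj.
Qed.

Lemma horizontal_cylinder (x : 'rV[R]_3) : horizontal_boundary x -> cylinder x.
Proof. by case=> rx [] x3; split; rewrite // x3 ?lexx ?ler01. Qed.

Lemma dotvE (u e : 'rV[R]_3) :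
  dotv u e = u 0 i1 * e 0 i1 + u 0 i2 * e 0 i2 + u 0 i3 * e 0 i3.
Proof. by rewrite /dotv sum3. Qed.

Lemma e_rE (x : 'rV[R]_3) : (e_r x 0 i1 = (Defs.radius x)^-1 * x 0 i1) *
  (e_r x 0 i2 = (Defs.radius x)^-1 * x 0 i2) * (e_r x 0 i3 = 0).
Proof. by rewrite /e_r !mxE/= !(mulr0, mulr1, addr0, add0r). Qed.

Lemma e_thetaE (x : 'rV[R]_3) : (e_theta x 0 i1 = (Defs.radius x)^-1 * - x 0 i2) *
  (e_theta x 0 i2 = (Defs.radius x)^-1 * x 0 i1) * (e_theta x 0 i3 = 0).
Proof. by rewrite /e_theta !mxE/= !(mulr0, mulr1, addr0, add0r). Qed.

(** Off the axis the frame is constant in the vertical direction, so the slip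
    condition says that the vertical derivatives of the horizontal Cartesian
    components vanish; on the axis this follows by continuity. *)
Lemma total_slip_cartesian (T : R) (v : spacetime R -> 'rV[R]_3) :
  smooth_on (domain T) v -> total_slip T v ->
  forall x t, horizontal_boundary x -> 0 <= t < T ->
    partial (Some i3) v (x, t) 0 i1 = 0 /\ partial (Some i3) v (x, t) 0 i2 = 0.
Proof.
move=> sv tsv.
have off x t : horizontal_boundary x -> 0 <= t < T -> 0 < Defs.radius x ->
    partial (Some i3) v (x, t) 0 i1 = 0 /\ partial (Some i3) v (x, t) 0 i2 = 0.
  move=> hx tT rx.
  have Az : domain T (x, t) by split => //=; exact: horizontal_cylinder.
  have [_ /(_ (Some i3)) dv] := smooth_onW [::] sv Az.
  have [_ /(_ rx) []] := tsv _ _ hx tT.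
  have de (e : 'rV[R]_3 -> 'rV[R]_3) :
      (forall x y : 'rV[R]_3, x 0 i1 = y 0 i1 -> x 0 i2 = y 0 i2 -> e x = e y) ->
      partial (Some i3) (fun z => dotv (v z) (e z.1)) (x, t) =
        dotv (partial (Some i3) v (x, t)) (e x).
    move=> He.
    have dei i : is_derive (x, t) (dir R (Some i3)) (fun z => e z.1 0 i) 0.
      apply: is_derive_invariant => h /=; congr (_ _ 0 i).
      by apply: He; rewrite !mxE/= mulr0 add0r.
    have dvi i := is_derive_coord i dv.
    rewrite /partial (_ : (fun z => _) = (fun z => v z 0 i1 * e z.1 0 i1) +
      (fun z => v z 0 i2 * e z.1 0 i2) + (fun z => v z 0 i3 * e z.1 0 i3)); last first.
      by apply/funext => z; rewrite dotvE.
    have H := is_deriveD (is_deriveD (is_deriveM (dvi i1) (dei i1))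
      (is_deriveM (dvi i2) (dei i2))) (is_deriveM (dvi i3) (dei i3)).
    rewrite (@derive_val _ _ _ _ _ _ _ H) dotvE /GRing.scale/=; ring.
  have rad (y z : 'rV[R]_3) : y 0 i1 = z 0 i1 -> y 0 i2 = z 0 i2 -> Defs.radius y = Defs.radius z.
    by rewrite /Defs.radius => -> ->.
  rewrite (de (@e_r R)); last first.
    by move=> y z yz1 yz2; rewrite /e_r (rad _ _ yz1 yz2) yz1 yz2.
  rewrite (de (@e_theta R)); last first.
    by move=> y z yz1 yz2; rewrite /e_theta (rad _ _ yz1 yz2) yz1 yz2.
  rewrite !dotvE !e_rE !e_thetaE !mulr0 !addr0.
  set a := partial (Some i3) v (x, t) 0 i1; set b := partial (Some i3) v (x, t) 0 i2.
  set r := Defs.radius x in rx *; have r0 : r != 0 by rewrite gt_eqF.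
  have r2 : r ^+ 2 = x 0 i1 ^+ 2 + x 0 i2 ^+ 2.
    by rewrite /r /Defs.radius sqr_sqrtr// addr_ge0// sqr_ge0.
  move=> h1 h2.
  have {}h1 : a * x 0 i1 + b * x 0 i2 = 0.
    by rewrite -(mul0r r) -h1; field.
  have {}h2 : - a * x 0 i2 + b * x 0 i1 = 0.
    by rewrite -(mul0r r) -h2; field.
  have r20 : r ^+ 2 != 0 by rewrite expf_neq0.
  split; apply: (mulIf r20); rewrite mul0r r2.
    rewrite (_ : _ * _ = (a * x 0 i1 + b * x 0 i2) * x 0 i1 -
      (- a * x 0 i2 + b * x 0 i1) * x 0 i2); last by ring.
    by rewrite h1 h2 !mul0r subr0.
  rewrite (_ : _ * _ = (a * x 0 i1 + b * x 0 i2) * x 0 i2 +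
    (- a * x 0 i2 + b * x 0 i1) * x 0 i1); last by ring.
  by rewrite h1 h2 !mul0r addr0.
move=> x t hx tT.
have [rx|rx] := ltP 0 (Defs.radius x); first exact: off.
have Az : domain T (x, t) by split => //=; exact: horizontal_cylinder.
have r0 : x 0 i1 ^+ 2 + x 0 i2 ^+ 2 = 0.
  have : Defs.radius x == 0 by rewrite eq_le rx sqrtr_ge0.
  by rewrite sqrtr_eq0 => h; apply/eqP; rewrite eq_le h addr_ge0// sqr_ge0.
have x1 : x 0 i1 = 0 by nra.
have x2 : x 0 i2 = 0 by nra.
(* on the axis: approach the point along the horizontal line [c] *)
pose c s := event (s, x 0 i2, x 0 i3) t.
have c0 : c 0 = (x, t) by rewrite /c -x1 /event point3_surj.
have cc : {for 0, continuous c} by exact: line_continuous (event_line1 (x 0 i2) (x 0 i3) t) 0.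
suff key i : (i = i1 \/ i = i2) -> partial (Some i3) v (x, t) 0 i = 0.
  by split; apply: key; [left|right].
move=> iE; apply/eqP; apply: contraT => n0.
have cg : {for (x, t), continuous (fun z => partial (Some i3) v z 0 i)}.
  by apply: continuous_coord; have [] := smooth_onW [:: Some i3] sv Az.
have : \forall s \near (0 : R), partial (Some i3) v (c s) 0 i != 0.
  have cgc : {for 0, continuous (fun s => partial (Some i3) v (c s) 0 i)}.
    have cg' : {for c 0, continuous (fun z => partial (Some i3) v z 0 i)} by rewrite c0.
    exact: (@continuous_comp _ _ _ c (fun z => partial (Some i3) v z 0 i) 0 cc cg').
  by apply: cvgr_neq0 cgc _; rewrite c0.
move=> [e /= e0 He].
pose s := Num.min 1 (e / 2).
have s0 : 0 < s by rewrite lt_min ltr01 divr_gt0.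
have : partial (Some i3) v (c s) 0 i != 0.
  apply: He; rewrite /ball_/= sub0r normrN gtr0_norm//.
  by rewrite (le_lt_trans (_ : _ <= e / 2)) ?ge_min ?lexx ?orbT//; lra.
have rs : Defs.radius (point3 (s, x 0 i2, x 0 i3)) = s.
  by rewrite /Defs.radius !point3E/= x2 expr0n/= addr0 sqrtr_sqr gtr0_norm.
have hs : horizontal_boundary (point3 (s, x 0 i2, x 0 i3)).
  split; first by rewrite rs ge_min lexx.
  by rewrite !point3E; exact: hx.2.
have [h1 h2] := off _ _ hs tT (eq_ind_r (fun r => 0 < r) s0 rs).
by case: iE => ->; rewrite /c /event ?h1 ?h2 eqxx.
Qed.

End Smooth.

Section EnergyBalance.
Variable R : realType.

Lemma momentum_coord (u : spacetime R -> 'rV[R]_3) (P : spacetime R -> R) z i :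
  (laplacian u z - advection u z - grad P z - partial None u z) 0 i =
  (partial (Some i1) (partial (Some i1) u) z 0 i +
   partial (Some i2) (partial (Some i2) u) z 0 i +
   partial (Some i3) (partial (Some i3) u) z 0 i) -
  (u z 0 i1 * partial (Some i1) u z 0 i + u z 0 i2 * partial (Some i2) u z 0 i +
   u z 0 i3 * partial (Some i3) u z 0 i) - partial (Some i) P z - partial None u z 0 i.
Proof.
have cB (a b : 'rV[R]_3) : (a - b) 0 i = a 0 i - b 0 i by rewrite !mxE.
have cD (a b : 'rV[R]_3) : (a + b) 0 i = a 0 i + b 0 i by rewrite mxE.
have cZ k (a : 'rV[R]_3) : (k *: a) 0 i = k * a 0 i by rewrite mxE.
rewrite 3!cB; congr (_ - _ - _ - _); last by rewrite /grad mxE.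
  by rewrite /laplacian sum3 2!cD.
by rewrite /advection sum3 2!cD; congr (_ + _ + _); exact: cZ.
Qed.

Lemma momentum_difference (F a1 a2 a3 b1 b2 b3 A B p q s t : R) :
  F = a1 + a2 + a3 - A - p - s -> F = b1 + b2 + b3 - B - q - t ->
  s - t = (a1 - b1) + (a2 - b2) + (a3 - b3) - (A - B) - (p - q).
Proof. lra. Qed.

(** The closed cylinder times a closed time interval is compact, which bounds the
    velocity gradient before the blow-up time. *)
Lemma bounded_derivatives (T t1 : R) (v : spacetime R -> 'rV[R]_3) :
  smooth_on (domain T) v -> t1 < T ->
  exists M, 0 <= M /\ forall j i x t, cylinder x -> 0 <= t <= t1 ->
    `|partial (Some j) v (x, t) 0 i| <= M.
Proof.
move=> sv t1T.
have B j i : exists M, 0 <= M /\ forall z, slab `[0, t1]%classic z ->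
    `|partial (Some j) v z 0 i| <= M.
  apply: slab_bounded; first exact: segment_compact.
  move=> [x t] [/= Dx]; rewrite /= in_itv/= => /andP[t0 tt1].
  apply: continuous_coord.
  have Az : domain T (x, t) by split; rewrite //= t0 (le_lt_trans tt1).
  by have [] := smooth_onW [:: Some j] sv Az.
have [m Hm] := choice (fun ji : 'I_3 * 'I_3 => B ji.1 ji.2).
exists (\sum_ji m ji); split; first by apply: sumr_ge0 => ji _; case: (Hm ji).
move=> j i x t Dx tt1; have [m0 Hmji] := Hm (j, i).
apply: (le_trans (Hmji (x, t) _)); first by split => //=; rewrite in_itv.
rewrite (bigD1 (j, i))//= lerDl; apply: sumr_ge0 => ji _; by case: (Hm ji).
Qed.

(** Pointwise form of the energy balance for the difference of two solutions:
    the viscous term loses a square and the transport by the second velocity is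
    conservative, so only the stretching of the difference by the gradient of
    the first velocity survives. *)
Lemma energy_balance (v1 v2 v3 u1 u2 u3 q q1 q2 q3
   dv11 dv12 dv13 dv21 dv22 dv23 dv31 dv32 dv33
   du11 du12 du13 du21 du22 du23 du31 du32 du33
   s11 s12 s13 s21 s22 s23 s31 s32 s33 t1 t2 t3 phi : R) :
  phi = 2^-1 * (u1 ^+ 2 + u2 ^+ 2 + u3 ^+ 2) ->
  du11 + du22 + du33 = 0 -> dv11 + dv22 + dv33 = 0 ->
  t1 = s11 + s21 + s31 - ((v1 + u1) * (dv11 + du11) + (v2 + u2) * (dv21 + du21)
     + (v3 + u3) * (dv31 + du31) - (v1 * dv11 + v2 * dv21 + v3 * dv31)) - q1 ->
  t2 = s12 + s22 + s32 - ((v1 + u1) * (dv12 + du12) + (v2 + u2) * (dv22 + du22)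
     + (v3 + u3) * (dv32 + du32) - (v1 * dv12 + v2 * dv22 + v3 * dv32)) - q2 ->
  t3 = s13 + s23 + s33 - ((v1 + u1) * (dv13 + du13) + (v2 + u2) * (dv23 + du23)
     + (v3 + u3) * (dv33 + du33) - (v1 * dv13 + v2 * dv23 + v3 * dv33)) - q3 ->
  u1 * t1 + u2 * t2 + u3 * t3 =
   ((du11 ^+ 2 + u1 * s11 + (du12 ^+ 2 + u2 * s12) + (du13 ^+ 2 + u3 * s13)
      - (dv11 + du11) * phi - (v1 + u1) * (u1 * du11 + u2 * du12 + u3 * du13)
      - du11 * q - u1 * q1)
   + (du21 ^+ 2 + u1 * s21 + (du22 ^+ 2 + u2 * s22) + (du23 ^+ 2 + u3 * s23)
      - (dv22 + du22) * phi - (v2 + u2) * (u1 * du21 + u2 * du22 + u3 * du23)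
      - du22 * q - u2 * q2)
   + (du31 ^+ 2 + u1 * s31 + (du32 ^+ 2 + u2 * s32) + (du33 ^+ 2 + u3 * s33)
      - (dv33 + du33) * phi - (v3 + u3) * (u1 * du31 + u2 * du32 + u3 * du33)
      - du33 * q - u3 * q3))
   - (du11 ^+ 2 + du12 ^+ 2 + du13 ^+ 2 + du21 ^+ 2 + du22 ^+ 2 + du23 ^+ 2
     + du31 ^+ 2 + du32 ^+ 2 + du33 ^+ 2)
   - (u1 * (u1 * dv11 + u2 * dv21 + u3 * dv31) + u2 * (u1 * dv12 + u2 * dv22 + u3 * dv32)
     + u3 * (u1 * dv13 + u2 * dv23 + u3 * dv33)).
Proof.
move=> -> du dv -> -> ->.
have -> : du33 = - du11 - du22 by rewrite -[LHS]add0r -[0]oppr0 -du; ring.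
have -> : dv33 = - dv11 - dv22 by rewrite -[LHS]add0r -[0]oppr0 -dv; ring.
by field.
Qed.

(** The energy flux through the boundary, component [u . d_j u - w_j phi - u_j q],
    vanishes under either boundary condition. *)
Lemma flux_no_slip (a b c d1 d2 d3 w phi u q : R) :
  a = 0 -> b = 0 -> c = 0 -> u = 0 -> phi = 2^-1 * (a ^+ 2 + b ^+ 2 + c ^+ 2) ->
  a * d1 + b * d2 + c * d3 - w * phi - u * q = 0.
Proof. by move=> -> -> -> -> ->; ring. Qed.

Lemma flux_total_slip (a b c d1 d2 d3 w phi q : R) :
  d1 = 0 -> d2 = 0 -> c = 0 -> w = 0 -> a * d1 + b * d2 + c * d3 - w * phi - c * q = 0.
Proof. by move=> -> -> -> ->; ring. Qed.

(** By the inequality between arithmetic and geometric means. *)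
Lemma stretching_bound (M : R) (u : 'I_3 -> R) (a : 'I_3 -> 'I_3 -> R) :
  (forall j i, `|a j i| <= M) ->
  - \sum_i u i * (\sum_j u j * a j i) <= 3 * M * \sum_i u i ^+ 2.
Proof.
move=> aM.
have H i j : - (u i * (u j * a j i)) <= M * (2^-1 * (u i ^+ 2 + u j ^+ 2)).
  have := aM j i; rewrite ler_norml => /andP[a1 a2].
  have M0 : 0 <= M by rewrite (le_trans _ (aM j i)).
  have [h|h] := leP 0 (u i * u j).
    rewrite mulrA -mulrN (le_trans (_ : _ <= u i * u j * M)) ?ler_wpM2l//; first by lra.
    rewrite mulrC ler_wpM2l//; have := sqr_ge0 (u i - u j); nra.
  rewrite mulrA -mulNr (le_trans (_ : _ <= - (u i * u j) * M)) ?ler_wpM2l//; first by lra.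
  rewrite mulrC ler_wpM2l//; have := sqr_ge0 (u i + u j); nra.
rewrite !sum3.
have := H i1 i1; have := H i1 i2; have := H i1 i3.
have := H i2 i1; have := H i2 i2; have := H i2 i3.
have := H i3 i1; have := H i3 i2; have := H i3 i3.
by rewrite !mulrDr; lra.
Qed.

(** The energy balance with its stretching term bounded. At one point, [v] and
    [w] are the velocities of two flows, [u] their difference, [dv], [dw], [du]
    the gradients ([dv j i] is the derivative of component [i] in direction
    [j]), [s] the second derivatives of [u], [t] its time derivative, [q] the
    pressure difference and [dq] its gradient; [F' j] is the derivative in
    direction [j] of the component [j] of the energy flux. *)
Lemma energy_inequality (M q phi : R) (v w u t dq F' : 'I_3 -> R) (dv dw du s : 'I_3 -> 'I_3 -> R) :
  (forall i, u i = w i - v i) -> (forall j i, du j i = dw j i - dv j i) ->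
  (forall j i, `|dv j i| <= M) ->
  phi = 2^-1 * (u i1 ^+ 2 + u i2 ^+ 2 + u i3 ^+ 2) ->
  dv i1 i1 + dv i2 i2 + dv i3 i3 = 0 -> dw i1 i1 + dw i2 i2 + dw i3 i3 = 0 ->
  (forall i, t i = s i1 i + s i2 i + s i3 i -
    ((w i1 * dw i1 i + w i2 * dw i2 i + w i3 * dw i3 i)
     - (v i1 * dv i1 i + v i2 * dv i2 i + v i3 * dv i3 i)) - dq i) ->
  (forall j, F' j = du j i1 ^+ 2 + u i1 * s j i1 + (du j i2 ^+ 2 + u i2 * s j i2)
      + (du j i3 ^+ 2 + u i3 * s j i3)
    - dw j j * phi - w j * (u i1 * du j i1 + u i2 * du j i2 + u i3 * du j i3)
    - du j j * q - u j * dq j) ->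
  u i1 * t i1 + u i2 * t i2 + u i3 * t i3 <= F' i1 + F' i2 + F' i3 + 6 * M * phi.
Proof.
move=> uE duE dvM phiE divv divw tE F'E.
have wE i : w i = v i + u i by rewrite uE subrKC.
have dwE j i : dw j i = dv j i + du j i by rewrite duE subrKC.
have divu : du i1 i1 + du i2 i2 + du i3 i3 = 0 by rewrite !duE; lra.
have tE' i : t i = s i1 i + s i2 i + s i3 i -
    ((v i1 + u i1) * (dv i1 i + du i1 i) + (v i2 + u i2) * (dv i2 i + du i2 i)
     + (v i3 + u i3) * (dv i3 i + du i3 i)
     - (v i1 * dv i1 i + v i2 * dv i2 i + v i3 * dv i3 i)) - dq i.
  by rewrite tE !wE !dwE.
rewrite (energy_balance q phiE divu divv (tE' i1) (tE' i2) (tE' i3)).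
have := stretching_bound u dvM; rewrite !sum3 => B.
have : 0 <= du i1 i1 ^+ 2 + du i1 i2 ^+ 2 + du i1 i3 ^+ 2
  + du i2 i1 ^+ 2 + du i2 i2 ^+ 2 + du i2 i3 ^+ 2
  + du i3 i1 ^+ 2 + du i3 i2 ^+ 2 + du i3 i3 ^+ 2 by rewrite !addr_ge0// sqr_ge0.
have -> : 6 * M * phi = 3 * M * (u i1 ^+ 2 + u i2 ^+ 2 + u i3 ^+ 2) by rewrite phiE; field.
rewrite !F'E !dwE !wE; move: B; lra.
Qed.

End EnergyBalance.

Section Uniqueness.
Variable R : realType.

(** The energy of the difference of two solutions with the same data is zero
    initially, and its time derivative is at most a multiple of itself plus a
    divergence without boundary flux. *)
Lemma NS_solution_unique (T : R) (f : spacetime R -> 'rV[R]_3) (v0 : 'rV[R]_3 -> 'rV[R]_3)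
    (v w : spacetime R -> 'rV[R]_3) (P Q : spacetime R -> R) :
  NS_solution T f v0 v P -> NS_solution T f v0 w Q ->
  forall z, domain T z -> w z = v z.
Proof.
move=> [sv sP mv iv inv nv tv] [sw sQ mw iw inw nw tw] [x0 t1] [/= Dx0 /andP[t10 t1T]].
have [M [M0 HM]] := bounded_derivatives sv t1T.
pose U i z := w z 0 i - v z 0 i.
pose dU d i z := partial d w z 0 i - partial d v z 0 i.
pose ddU j i z := partial (Some j) (partial (Some j) w) z 0 i -
  partial (Some j) (partial (Some j) v) z 0 i.
pose q z := Q z - P z.
pose dq j z := partial (Some j) Q z - partial (Some j) P z.
pose phi z := 2^-1 * (U i1 z ^+ 2 + U i2 z ^+ 2 + U i3 z ^+ 2).
pose phi' z := U i1 z * dU None i1 z + U i2 z * dU None i2 z + U i3 z * dU None i3 z.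
pose UdU j z := U i1 z * dU (Some j) i1 z + U i2 z * dU (Some j) i2 z + U i3 z * dU (Some j) i3 z.
(* the energy flux and its diagonal derivatives *)
pose F j z := UdU j z - w z 0 j * phi z - U j z * q z.
pose F' j z := (dU (Some j) i1 z ^+ 2 + U i1 z * ddU j i1 z +
     (dU (Some j) i2 z ^+ 2 + U i2 z * ddU j i2 z) +
     (dU (Some j) i3 z ^+ 2 + U i3 z * ddU j i3 z))
   - partial (Some j) w z 0 j * phi z - w z 0 j * UdU j z
   - dU (Some j) j z * q z - U j z * dq j z.
have dom x t : cylinder x -> 0 <= t <= t1 -> domain T (x, t).
  by move=> Dx /andP[t0 tt1]; split => //=; rewrite t0 (le_lt_trans tt1).
have cc (u : spacetime R -> 'rV[R]_3) s i z : smooth_on (domain T) u -> domain T z ->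
    {for z, continuous (fun z => iter_partial s u z 0 i)}.
  by move=> su Dz; apply: continuous_coord; have [] := smooth_onW s su Dz.
have cd (u : spacetime R -> 'rV[R]_3) s d i z : smooth_on (domain T) u -> domain T z ->
    is_derive z (dir R d) (fun z => iter_partial s u z 0 i) (iter_partial (d :: s) u z 0 i).
  by move=> su Dz; apply: is_derive_coord; have [_] := smooth_onW s su Dz.
have cU i z : domain T z -> {for z, continuous (U i)}.
  by move=> Dz; apply: cvgB; [exact: (cc w [::])|exact: (cc v [::])].
have cdU d i z : domain T z -> {for z, continuous (dU d i)}.
  by move=> Dz; apply: cvgB; [exact: (cc w [:: d])|exact: (cc v [:: d])].
have cddU j i z : domain T z -> {for z, continuous (ddU j i)}.
  by move=> Dz; apply: cvgB; [exact: (cc w [:: Some j; Some j])|exact: (cc v [:: Some j; Some j])].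
have cq z : domain T z -> {for z, continuous q}.
  by move=> Dz; apply: cvgB; [have [] := smooth_onW [::] sQ Dz|have [] := smooth_onW [::] sP Dz].
have cdq j z : domain T z -> {for z, continuous (dq j)}.
  by move=> Dz; apply: cvgB; [have [] := smooth_onW [:: Some j] sQ Dz
    |have [] := smooth_onW [:: Some j] sP Dz].
have dUP d i z : domain T z -> is_derive z (dir R d) (U i) (dU d i z).
  by move=> Dz; exact: (is_deriveB (cd w [::] d i z sw Dz) (cd v [::] d i z sv Dz)).
have ddUP j i z : domain T z -> is_derive z (dir R (Some j)) (dU (Some j) i) (ddU j i z).
  by move=> Dz; exact: (is_deriveB (cd w [:: Some j] (Some j) i z sw Dz)
    (cd v [:: Some j] (Some j) i z sv Dz)).
have dqP j z : domain T z -> is_derive z (dir R (Some j)) q (dq j z).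
  move=> Dz; have [_ /(_ (Some j)) dQ] := smooth_onW [::] sQ Dz.
  have [_ /(_ (Some j)) dP] := smooth_onW [::] sP Dz.
  exact: (is_deriveB (derivableP dQ) (derivableP dP)).
have cX (g : spacetime R -> R) z : {for z, continuous g} -> {for z, continuous (fun z => g z ^+ 2)}.
  by move=> cg; apply: (@continuous_comp _ _ _ g (fun r => r ^+ 2)) => //; exact: exprn_continuous.
have cphi z : domain T z -> {for z, continuous phi}.
  move=> Dz; apply: cvgM; first exact: cvg_cst.
  by apply: cvgD; [apply: cvgD|]; apply: cX; exact: cU.
have cUdU j z : domain T z -> {for z, continuous (UdU j)}.
  by move=> Dz; apply: cvgD; [apply: cvgD|]; (apply: cvgM; [exact: cU|exact: cdU]).
have sqE (r : R) : r ^+ 2 = r * r by rewrite expr2.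
have dphi d z : domain T z -> is_derive z (dir R d) phi
    (U i1 z * dU d i1 z + U i2 z * dU d i2 z + U i3 z * dU d i3 z).
  move=> Dz.
  have dM i := is_deriveM (dUP d i z Dz) (dUP d i z Dz).
  have H := is_deriveZ 2^-1 (is_deriveD (is_deriveD (dM i1) (dM i2)) (dM i3)).
  rewrite (_ : phi = 2^-1 \*: (U i1 * U i1 + U i2 * U i2 + U i3 * U i3)).
    by apply: (is_derive_eq H); rewrite /GRing.scale/=; field.
  by apply/funext => y; rewrite /phi !sqE.
have dF j z : domain T z -> is_derive z (dir R (Some j)) (F j) (F' j z).
  move=> Dz.
  have dM i := is_deriveM (dUP (Some j) i z Dz) (ddUP j i z Dz).
  have H1 := is_deriveD (is_deriveD (dM i1) (dM i2)) (dM i3).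
  have H2 := is_deriveM (cd w [::] (Some j) j z sw Dz) (dphi (Some j) z Dz).
  have H3 := is_deriveM (dUP (Some j) j z Dz) (dqP j z Dz).
  have H := is_deriveB (is_deriveB H1 H2) H3.
  by apply: (is_derive_eq H); rewrite /F' /UdU /GRing.scale/=; ring.
have cF' j z : domain T z -> {for z, continuous (F' j)}.
  move=> Dz.
  have c1 i : {for z, continuous (fun z => dU (Some j) i z ^+ 2 + U i z * ddU j i z)}.
    by apply: cvgD; [apply: cX; exact: cdU|apply: cvgM; [exact: cU|exact: cddU]].
  apply: cvgB; last by apply: cvgM; [exact: cU|exact: cdq].
  apply: cvgB; last by apply: cvgM; [exact: cdU|exact: cq].
  apply: cvgB; last by apply: cvgM; [exact: (cc w [::])|exact: cUdU].
  apply: cvgB; last by apply: cvgM; [exact: (cc w [:: Some j])|exact: cphi].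
  by apply: cvgD; [apply: cvgD|]; exact: c1.
have phi_x0 : phi (x0, t1) = 0.
  apply: (@energy_vanishes R t1 (6 * M) phi phi' F F') => //.
  - move=> x t Dx tI; have Dz := dom _ _ Dx tI; split.
    + exact: dphi.
    + exact: cphi.
    + by apply: cvgD; [apply: cvgD|]; (apply: cvgM; [exact: cU|exact: cdU]).
    + by rewrite /phi mulr_ge0// ?invr_ge0// !addr_ge0// sqr_ge0.
  - by move=> j x t Dx tI; have Dz := dom _ _ Dx tI; split; [exact: dF|exact: cF'].
  - move=> x t Dx tI; have Dz := dom _ _ Dx tI.
    have divv := iv _ Dz; have divw := iw _ Dz.
    rewrite /divergence !sum3 in divv divw.
    apply: (@energy_inequality R M (q (x, t)) _ (fun i => v (x, t) 0 i) (fun i => w (x, t) 0 i)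
      (fun i => U i (x, t)) (fun i => dU None i (x, t)) (fun i => dq i (x, t)) (fun i => F' i (x, t))
      (fun j i => partial (Some j) v (x, t) 0 i) (fun j i => partial (Some j) w (x, t) 0 i)
      (fun j i => dU (Some j) i (x, t)) (fun j i => ddU j i (x, t))) => //.
    + by move=> j i; exact: HM.
    + move=> i.
      have E1 := momentum_coord w Q (x, t) i; rewrite (mw _ Dz) in E1.
      have E2 := momentum_coord v P (x, t) i; rewrite (mv _ Dz) in E2.
      exact: momentum_difference E1 E2.
  - move=> x t vx tI.
    have tI' : 0 <= t < T by case/andP: tI => -> /= ?; exact: le_lt_trans t1T.
    have U0 i : U i (x, t) = 0 by rewrite /U nv// nw// !mxE subrr.
    split; apply: flux_no_slip; first [exact: U0|reflexivity].
  - move=> x t hx tI.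
    have tI' : 0 <= t < T by case/andP: tI => -> /= ?; exact: le_lt_trans t1T.
    have [w3 _] := tw _ _ hx tI'; have [v3 _] := tv _ _ hx tI'.
    have [w31 w32] := total_slip_cartesian sw tw hx tI'.
    have [v31 v32] := total_slip_cartesian sv tv hx tI'.
    apply: flux_total_slip => //.
    + by rewrite /dU w31 v31 subrr.
    + by rewrite /dU w32 v32 subrr.
    + by rewrite /U w3 v3 subrr.
  - move=> x Dx; rewrite /phi /U inw// inv// !subrr expr0n/= !addr0 mulr0//.
have U0 i : U i (x0, t1) = 0.
  move: phi_x0; rewrite /phi; have := sqr_ge0 (U i1 (x0, t1)).
  have := sqr_ge0 (U i2 (x0, t1)); have := sqr_ge0 (U i3 (x0, t1)).
  by move=> *; apply/eqP; rewrite -sqrf_eq0; apply/eqP; case: (ord3P i) => ->; lra.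
by apply/rowP => i; apply/eqP; rewrite -subr_eq0; apply/eqP; exact: (U0 i).
Qed.

End Uniqueness.

(** * Functions of given parabolic weight *)

Section Weighted.
Variables (R : realType) (T : R).

(** The squared parabolic distance to the blow-up set, which is the axis at time
    [T]. *)
Definition pardist (z : spacetime R) : R :=
  z.1 0 i1 ^+ 2 + z.1 0 i2 ^+ 2 + (T - z.2).

(** Under the parabolic scaling a horizontal coordinate has weight 1 / 2, a power
    of [pardist] its exponent. This class is closed under differentiation and
    its members are controlled by a power of [pardist], so that smoothness and
    bounds of the solution and its force need no explicit formulas. *)
Inductive weighted : R -> (spacetime R -> R) -> Prop :=
| weighted0 w : weighted w (fun=> 0)
| weighted_cst a : weighted 0 (fun=> a)
| weighted_coord j : j = i1 \/ j = i2 -> weighted 2^-1 (fun z => z.1 0 j)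
| weighted_pow c : weighted c (fun z => pardist z `^ c)
| weightedD w f g : weighted w f -> weighted w g -> weighted w (fun z => f z + g z)
| weightedM w w' f g : weighted w f -> weighted w' g ->
    weighted (w + w') (fun z => f z * g z)
| weightedW w w' f : w' <= w -> weighted w f -> weighted w' f.

Lemma weightedZ w a f : weighted w f -> weighted w (fun z => a * f z).
Proof.
by move=> wf; apply: (@weightedW (0 + w)); [rewrite add0r|apply: weightedM => //; exact: weighted_cst].
Qed.

Lemma weightedN w f : weighted w f -> weighted w (fun z => - f z).
Proof.
by move=> wf; rewrite (_ : (fun z => _) = fun z => -1 * f z);
  [exact: weightedZ|apply/funext => z; rewrite mulN1r].
Qed.

Lemma weightedB w f g : weighted w f -> weighted w g -> weighted w (fun z => f z - g z).
Proof. by move=> wf wg; apply: weightedD => //; exact: weightedN. Qed.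

Definition parabolic_order (d : option 'I_3) : R := if d is Some _ then 2^-1 else 1.

Lemma pardist_gt0 z : z.2 < T -> 0 < pardist z.
Proof. by move=> zT; rewrite ltr_wpDl ?subr_gt0// addr_ge0// sqr_ge0. Qed.

Lemma is_derive_coordinate z v j : is_derive z v (fun z : spacetime R => z.1 0 j) (v.1 0 j).
Proof. by apply: is_derive_affine => h /=; rewrite !mxE addrC. Qed.

Lemma is_derive_time z (v : spacetime R) : is_derive z v (fun z : spacetime R => z.2) v.2.
Proof. by apply: is_derive_affine => h /=; rewrite addrC. Qed.

Lemma is_derive_pardist z v : is_derive z v pardist
  (2 * (z.1 0 i1 * v.1 0 i1 + z.1 0 i2 * v.1 0 i2) - v.2).
Proof.
have d1 := is_derive_coordinate z v i1; have d2 := is_derive_coordinate z v i2.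
have H := is_deriveD (is_deriveD (is_deriveM d1 d1) (is_deriveM d2 d2))
  (is_deriveB (is_derive_cst T z v) (is_derive_time z v)).
by apply: (is_derive_eq H); rewrite /GRing.scale/=; ring.
Qed.

Lemma is_derive_pardist_pow c z v : z.2 < T -> is_derive z v (fun z => pardist z `^ c)
  (c * pardist z `^ (c - 1) * (2 * (z.1 0 i1 * v.1 0 i1 + z.1 0 i2 * v.1 0 i2) - v.2)).
Proof.
move=> /pardist_gt0 z0.
exact: (is_derive_chain (is_derive1_powR c z0) (is_derive_pardist z v)).
Qed.

Lemma dir_coord j d : (dir R d).1 0 j = (d == Some j)%:R :> R.
Proof.
case: d => [k|] /=; last by rewrite mxE.
by rewrite mxE/= eq_sym.
Qed.

(** Each space derivative costs half a unit of weight, a time derivative a full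
    unit. *)
Lemma weighted_derive w f d : weighted w f ->
  exists f', weighted (w - parabolic_order d) f' /\
    forall z, z.2 < T -> is_derive z (dir R d) f (f' z).
Proof.
elim=> {w f}.
- move=> w; exists (fun=> 0); split; first exact: weighted0.
  by move=> z _; exact: is_derive_cst.
- move=> a; exists (fun=> 0); split; first exact: weighted0.
  by move=> z _; exact: is_derive_cst.
- move=> j _; exists (fun=> (d == Some j)%:R); split; last first.
    by move=> z _; rewrite -dir_coord; exact: is_derive_coordinate.
  case: d => [k|]; last exact: weighted0.
  by apply: (@weightedW 0); [rewrite subrr|exact: weighted_cst].
- move=> c; exists (fun z => c * pardist z `^ (c - 1) * (2 * (z.1 0 i1 * (dir R d).1 0 i1
    + z.1 0 i2 * (dir R d).1 0 i2) - (dir R d).2)); split; last first.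
    by move=> z; exact: is_derive_pardist_pow.
  have wp : weighted (c - 1) (fun z => c * pardist z `^ (c - 1)).
    by apply: weightedZ; exact: weighted_pow.
  case: d => [k|] /=.
    apply: (@weightedW (c - 1 + 2^-1)); first by lra.
    apply: weightedM => //.
    have -> : (fun z : spacetime R => 2 * (z.1 0 i1 * (delta_mx 0 k : 'rV[R]_3) 0 i1
        + z.1 0 i2 * (delta_mx 0 k : 'rV[R]_3) 0 i2) - 0) =
      fun z => (2 * (delta_mx 0 k : 'rV[R]_3) 0 i1) * z.1 0 i1 +
               (2 * (delta_mx 0 k : 'rV[R]_3) 0 i2) * z.1 0 i2.
      by apply/funext => z; ring.
    by apply: weightedD; apply: weightedZ; apply: weighted_coord; [left|right].
  have -> : (fun z : spacetime R => c * pardist z `^ (c - 1) *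
        (2 * (z.1 0 i1 * (0 : 'rV[R]_3) 0 i1 + z.1 0 i2 * (0 : 'rV[R]_3) 0 i2) - 1)) =
      fun z => - (c * pardist z `^ (c - 1)).
    by apply/funext => z; rewrite !mxE; ring.
  exact: weightedN.
- move=> w f g _ [f' [wf' df]] _ [g' [wg' dg]].
  exists (fun z => f' z + g' z); split; first exact: weightedD.
  by move=> z zT; exact: (is_deriveD (df z zT) (dg z zT)).
- move=> w w' f g wf [f' [wf' df]] wg [g' [wg' dg]].
  exists (fun z => f z * g' z + f' z * g z); split.
    apply: weightedD.
      by rewrite -addrA; exact: weightedM.
    by rewrite addrAC; exact: weightedM.
  move=> z zT; apply: (is_derive_eq (is_deriveM (df z zT) (dg z zT))).
  by rewrite /GRing.scale/= [g z * _]mulrC.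
- move=> w w' f ww' _ [f' [wf' df]]; exists f'; split => //.
  by apply: (weightedW _ wf'); rewrite lerB.
Qed.

Lemma continuous_coordinate j : continuous (fun z : spacetime R => z.1 0 j).
Proof.
by move=> z; exact: (@continuous_comp _ _ _ fst (fun x : 'rV[R]_3 => x 0 j) z cvg_fst
  (@coord_cts R j _)).
Qed.

Lemma continuous_pardist : continuous pardist.
Proof.
have c1 j : continuous (fun z : spacetime R => z.1 0 j ^+ 2).
  move=> z; apply: (@continuous_comp _ _ _ (fun z : spacetime R => z.1 0 j) (fun r => r ^+ 2)).
    exact: continuous_coordinate.
  exact: exprn_continuous.
move=> z; apply: cvgD; first by apply: cvgD; exact: c1.
by apply: cvgB; [exact: cvg_cst|exact: cvg_snd].
Qed.

Lemma weighted_continuous w f z : weighted w f -> z.2 < T -> {for z, continuous f}.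
Proof.
move=> + zT; elim=> {w f}.
- by move=> w; exact: cvg_cst.
- by move=> a; exact: cvg_cst.
- by move=> j _; exact: continuous_coordinate.
- move=> c; apply: (@continuous_comp _ _ _ pardist (fun r => r `^ c)).
    exact: continuous_pardist.
  apply/differentiable_continuous/derivable1_diffP.
  by have [] := is_derive1_powR c (pardist_gt0 zT).
- by move=> w f g _ cf _ cg; exact: cvgD.
- by move=> w w' f g _ cf _ cg; exact: cvgM.
- by [].
Qed.

Lemma weighted_bound w f (B : R) : weighted w f ->
  exists2 C, 0 <= C & forall z, z.2 < T -> pardist z <= B -> `|f z| <= C * pardist z `^ w.
Proof.
elim=> {w f}.
- by move=> w; exists 0 => // z _ _; rewrite normr0 mul0r.
- by move=> a; exists `|a| => // z _ _; rewrite powRr0 mulr1.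
- move=> j jE; exists 1 => // z zT _; rewrite mul1r powR12_sqrt; last exact/ltW/pardist_gt0.
  rewrite -sqrtr_sqr ler_sqrt; last exact/ltW/pardist_gt0.
  rewrite /pardist.
  have := sqr_ge0 (z.1 0 i1); have := sqr_ge0 (z.1 0 i2).
  by case: jE => -> *; lra.
- by move=> c; exists 1 => // z zT _; rewrite mul1r ger0_norm// powR_ge0.
- move=> w f g _ [C C0 fC] _ [D D0 gD]; exists (C + D); first exact: addr_ge0.
  move=> z zT zB; rewrite (le_trans (ler_normD _ _))// mulrDl.
  by rewrite lerD ?fC ?gD.
- move=> w w' f g _ [C C0 fC] _ [D D0 gD]; exists (C * D); first exact: mulr_ge0.
  move=> z zT zB; rewrite normrM powRD; last by apply/implyP => _; rewrite gt_eqF// pardist_gt0.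
  rewrite mulrACA; apply: ler_pM => //; [exact: fC|exact: gD].
- move=> w w' f ww' _ [C C0 fC].
  exists (C * `|B| `^ (w - w')); first by rewrite mulr_ge0// powR_ge0.
  move=> z zT zB; rewrite (le_trans (fC z zT zB))// -mulrA ler_wpM2l//.
  have z0 := pardist_gt0 zT.
  have -> : pardist z `^ w = pardist z `^ (w - w') * pardist z `^ w'.
    by rewrite -powRD ?subrK//; apply/implyP => _; rewrite gt_eqF.
  apply: ler_wpM2r; first exact: powR_ge0.
  apply: ge0_ler_powR; rewrite ?nnegrE ?subr_ge0 ?normr_ge0//; first exact: ltW.
  exact: le_trans zB (ler_norm _).
Qed.

(** Vector fields with weighted components; equality is only required before the
    blow-up time, as derivatives are only controlled there. *)
Definition weightedv w (u : spacetime R -> 'rV[R]_3) :=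
  exists2 h : 'I_3 -> spacetime R -> R, (forall i, weighted w (h i)) &
    forall z i, z.2 < T -> u z 0 i = h i z.

Lemma near_before (z : spacetime R) : z.2 < T -> \near z, z.2 < T.
Proof.
have H : (fun z : spacetime R => z.2) @ z --> z.2 by exact: cvg_snd.
by move=> zT; exact: cvgr_lt H _ zT.
Qed.

Lemma continuous_row (V : topologicalType) n (u : V -> 'rV[R]_n) z :
  (forall i, {for z, continuous (fun z => u z 0 i)}) -> {for z, continuous u}.
Proof.
move=> cu; apply/cvgrPdist_le => e e0; near=> y.
rewrite [leLHS]/Num.Def.normr/= mx_normrE bigmax_le ?(ltW e0)// => -[i j] _ /=.
rewrite ord1 !mxE; move: j; near: y; apply: filter_forall => j.
exact: ((cvgrPdist_le _ _).1 (cu j)).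
Unshelve. all: by end_near. Qed.

Lemma weightedv_derive w u d : weightedv w u ->
  (forall z, z.2 < T -> {for z, continuous u} /\ derivable u z (dir R d)) /\
  weightedv (w - parabolic_order d) (partial d u).
Proof.
move=> [h wh uh].
have [h' H] := choice (fun i => weighted_derive d (wh i)).
have dui z i : z.2 < T -> is_derive z (dir R d) (fun z => u z 0 i) (h' i z).
  move=> zT; apply: (@near_eq_is_derive _ _ _ (h i)).
    by near=> y; rewrite uh//; near: y; exact: near_before.
  by have [_] := H i; apply.
have du z : z.2 < T -> derivable u z (dir R d).
  move=> zT; apply/derivable_mxP => i j; rewrite ord1.
  by have [] := dui z j zT.
split.
- move=> z zT; split; last exact: du.
  apply: continuous_row => i.
  have : {for z, continuous (h i)} by exact: weighted_continuous zT.
  rewrite /prop_for /continuous_at uh// => ch.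
  apply: cvg_trans ch; apply: near_eq_cvg.
  by near=> y; rewrite uh//; near: y; exact: near_before.
- exists h'; first by move=> i; have [] := H i.
  move=> z i zT; rewrite /partial derive_mx; last exact: du.
  by rewrite mxE; have [] := dui z i zT.
Unshelve. all: by end_near. Qed.

End Weighted.

(** * The vortex solution *)

Section Vortex.
Variables (R : realType) (T b : R).
Local Notation Y := (@pardist R T).
Local Notation weightedv := (@weightedv R T).

Lemma weightedv_smooth w u : weightedv w u -> smooth_on (domain T) u.
Proof.
move=> wu; exists [set z | z.2 < T]; split.
- rewrite (_ : mkset _ = snd @^-1` [set t : R | t < T])//.
  by apply: open_comp => [z _|]; [exact: cvg_snd|exact: open_lt].
- by move=> [x t] [_ /= /andP[]].
- move=> s z /= zT.
  have [w' ws] : exists w', weightedv w' (iter_partial s u).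
    elim: s => [|d s [w' ws]]; first by exists w.
    by exists (w' - parabolic_order R d); exact: (weightedv_derive d ws).2.
  split; first by have [/(_ _ zT) []] := weightedv_derive None ws.
  by move=> d; have [/(_ _ zT) []] := weightedv_derive d ws.
Qed.

Lemma smooth_on0 (A : set (spacetime R)) : smooth_on A (fun=> 0 : R).
Proof.
exists setT; split => //; first exact: openT.
move=> s z _; suff -> : iter_partial s (fun=> 0 : R) = (fun=> 0) :> (spacetime R -> R).
  by split => [|d]; [exact: cvg_cst|exact: derivable_cst].
by elim: s => // d s IH; apply/funext => y; rewrite /= IH /partial derive_cst.
Qed.

(** Angular velocity of a vortex concentrating on the axis. *)
Definition spin (z : spacetime R) : R :=
  (1 - (z.1 0 i1 ^+ 2 + z.1 0 i2 ^+ 2)) * Y z `^ (- b).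

Definition vortex (z : spacetime R) : 'rV[R]_3 :=
  spin z *: (- z.1 0 i2 *: delta_mx 0 i1 + z.1 0 i1 *: delta_mx 0 i2).

Lemma vortexE z : (vortex z 0 i1 = spin z * - z.1 0 i2) *
  (vortex z 0 i2 = spin z * z.1 0 i1) * (vortex z 0 i3 = 0).
Proof. by rewrite /vortex !mxE/= !(mulr0, mulr1, addr0, add0r). Qed.

Lemma weighted_spin : weighted T (- b) spin.
Proof.
apply: (@weightedW _ _ (0 + - b)); first by rewrite add0r.
apply: weightedM; last exact: weighted_pow.
apply: weightedB; first exact: weighted_cst.
have wsq j : j = i1 \/ j = i2 -> weighted T 0 (fun z : spacetime R => z.1 0 j ^+ 2).
  move=> jE; apply: (@weightedW _ _ (2^-1 + 2^-1)); first by lra.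
  by apply: weightedM; exact: weighted_coord.
by apply: weightedD; apply: wsq; [left|right].
Qed.

Lemma weighted_vortex : weightedv (2^-1 - b) vortex.
Proof.
exists (fun i z => vortex z 0 i) => // i.
have wx j : j = i1 \/ j = i2 -> weighted T (2^-1 - b) (fun z => spin z * z.1 0 j).
  move=> jE; rewrite addrC; apply: weightedM; first exact: weighted_spin.
  exact: weighted_coord.
case: (ord3P i) => ->.
- rewrite (_ : (fun z => _) = fun z => - (spin z * z.1 0 i2)).
    by apply: weightedN; apply: wx; right.
  by apply/funext => z; rewrite vortexE mulrN.
- rewrite (_ : (fun z => _) = fun z => spin z * z.1 0 i1).
    by apply: wx; left.
  by apply/funext => z; rewrite vortexE.
- rewrite (_ : (fun z => _) = fun=> 0); first exact: weighted0.
  by apply/funext => z; rewrite vortexE.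
Qed.

Definition vortex_force (z : spacetime R) : 'rV[R]_3 :=
  laplacian vortex z - advection vortex z - grad (fun=> 0) z - partial None vortex z.

Let sum_congr (a1 a2 a3 a1' a2' a3' c1 c2 c3 c1' c2' c3' p s s' : R) :
  a1 = a1' -> a2 = a2' -> a3 = a3' -> c1 = c1' -> c2 = c2' -> c3 = c3' -> p = 0 -> s = s' ->
  (a1 + a2 + a3) - (c1 + c2 + c3) - p - s = (a1' + a2' + a3') - (c1' + c2' + c3') - s'.
Proof. by move=> -> -> -> -> -> -> -> ->; rewrite subr0. Qed.

Lemma weighted_force : b <= 1 -> weightedv (- 2^-1 - b) vortex_force.
Proof.
move=> b1.
have [_ wd] := all_and2 (fun d => weightedv_derive d weighted_vortex).
have [_ wdd] := all_and2 (fun j => weightedv_derive (Some j) (wd (Some j))).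
have [h wh hE] := weighted_vortex.
have [hd whd hdE] : exists2 hd : option 'I_3 -> 'I_3 -> spacetime R -> R,
    (forall d i, weighted T (2^-1 - b - parabolic_order R d) (hd d i)) &
    (forall d z i, z.2 < T -> partial d vortex z 0 i = hd d i z).
  have [hd H] := choice (fun d => let: ex_intro2 k a c := wd d in ex_intro _ k (conj a c)).
  by exists hd => [d i|d z i zT]; have [H1 H2] := H d; [exact: H1|exact: H2].
have [hdd whdd hddE] : exists2 hdd : 'I_3 -> 'I_3 -> spacetime R -> R,
    (forall j i, weighted T (2^-1 - b - 2^-1 - 2^-1) (hdd j i)) &
    (forall j z i, z.2 < T -> partial (Some j) (partial (Some j) vortex) z 0 i = hdd j i z).
  have [hdd H] := choice (fun j => let: ex_intro2 k a c := wdd j in ex_intro _ k (conj a c)).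
  by exists hdd => [d i|d z i zT]; have [H1 H2] := H d; [exact: H1|exact: H2].
exists (fun i z => (hdd i1 i z + hdd i2 i z + hdd i3 i z) -
  (h i1 z * hd (Some i1) i z + h i2 z * hd (Some i2) i z + h i3 z * hd (Some i3) i z)
  - hd None i z); last first.
  move=> z i zT; apply: (etrans (momentum_coord vortex (fun=> 0) z i)).
  have p0 : partial (Some i) (fun=> 0 : R) z = 0 by rewrite /partial derive_cst.
  have hM j : vortex z 0 j * partial (Some j) vortex z 0 i = h j z * hd (Some j) i z.
    exact: congr2 (hE z j zT) (hdE (Some j) z i zT).
  exact: (sum_congr (hddE i1 z i zT) (hddE i2 z i zT) (hddE i3 z i zT)
    (hM i1) (hM i2) (hM i3) p0 (hdE None z i zT)).
move=> i; apply: weightedB; first apply: weightedB.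
- have w1 j : weighted T (- 2^-1 - b) (hdd j i) by apply: weightedW (whdd j i); lra.
  by apply: weightedD => //; exact: weightedD.
- have w1 j : weighted T (- 2^-1 - b) (fun z => h j z * hd (Some j) i z).
    by apply: weightedW (weightedM (wh j) (whd (Some j) i)); rewrite /parabolic_order; lra.
  by apply: weightedD => //; exact: weightedD.
- by apply: weightedW (whd None i); rewrite /parabolic_order; lra.
Qed.

Lemma is_derive_spin z v : z.2 < T -> is_derive z v spin
  ((1 - (z.1 0 i1 ^+ 2 + z.1 0 i2 ^+ 2)) * (- b * Y z `^ (- b - 1) *
     (2 * (z.1 0 i1 * v.1 0 i1 + z.1 0 i2 * v.1 0 i2) - v.2))
   - 2 * (z.1 0 i1 * v.1 0 i1 + z.1 0 i2 * v.1 0 i2) * Y z `^ (- b)).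
Proof.
move=> zT.
have d1 := is_derive_coordinate z v i1; have d2 := is_derive_coordinate z v i2.
have H := is_deriveM (is_deriveB (is_derive_cst (1 : R) z v)
  (is_deriveD (is_deriveM d1 d1) (is_deriveM d2 d2)))
  (is_derive_pardist_pow (- b) v zT).
apply: (is_derive_eq H); rewrite /GRing.scale/=.
rewrite (_ : (cst 1 - _) z = 1 - (z.1 0 i1 * z.1 0 i1 + z.1 0 i2 * z.1 0 i2)) //.
by ring.
Qed.

(** The flow is a rotation about the axis with an angular velocity that depends
    on the distance to the axis only. *)
Lemma divergence_vortex z : z.2 < T -> divergence vortex z = 0.
Proof.
move=> zT.
have dv d : derivable vortex z (dir R d).
  by have [/(_ _ zT) []] := weightedv_derive d weighted_vortex.
have D d i l : is_derive z (dir R d) (fun z => vortex z 0 i) l -> partial d vortex z 0 i = l.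
  by move=> [_ <-]; have [_ <-] := is_derive_coord i (dv d).
pose A := (1 - (z.1 0 i1 ^+ 2 + z.1 0 i2 ^+ 2)) * (- b * Y z `^ (- b - 1) * 2) - 2 * Y z `^ (- b).
have ds j k : j = i1 /\ k = i2 \/ j = i2 /\ k = i1 ->
    is_derive z (dir R (Some j)) (fun z => spin z * z.1 0 k) (z.1 0 j * z.1 0 k * A).
  move=> jk; have H := is_deriveM (is_derive_spin (dir R (Some j)) zT)
    (is_derive_coordinate z (dir R (Some j)) k).
  apply: (is_derive_eq H); rewrite /GRing.scale/= /A.
  by case: jk => -[-> ->]; rewrite !mxE/=; ring.
have P1 : partial (Some i1) vortex z 0 i1 = - (z.1 0 i1 * z.1 0 i2 * A).
  apply: D; have -> : (fun z => vortex z 0 i1) = - (fun z : spacetime R => spin z * z.1 0 i2).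
    by apply/funext => y; rewrite vortexE mulrN.
  by apply: is_deriveN; apply: ds; left.
have P2 : partial (Some i2) vortex z 0 i2 = z.1 0 i2 * z.1 0 i1 * A.
  apply: D; have -> : (fun z => vortex z 0 i2) = (fun z : spacetime R => spin z * z.1 0 i1).
    by apply/funext => y; rewrite vortexE.
  by apply: ds; right.
have P3 : partial (Some i3) vortex z 0 i3 = 0.
  apply: D; have -> : (fun z => vortex z 0 i3) = (fun=> 0 : R).
    by apply/funext => y; rewrite vortexE.
  exact: is_derive_cst.
apply: (etrans (sum3 (fun j => partial (Some j) vortex z 0 j))).
apply: (etrans (congr2 +%R (congr2 +%R P1 P2) P3)).
by rewrite addr0 [z.1 0 i2 * _]mulrC addNr.
Qed.

Lemma vortex_total_slip : total_slip T vortex.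
Proof.
move=> x t _ _; split; first by rewrite vortexE.
have inv (e : 'rV[R]_3 -> 'rV[R]_3) :
    (forall y z : 'rV[R]_3, y 0 i1 = z 0 i1 -> y 0 i2 = z 0 i2 -> e y = e z) ->
    partial (Some i3) (fun z => dotv (vortex z) (e z.1)) (x, t) = 0.
  move=> He; suff H : is_derive (x, t) (dir R (Some i3))
      (fun z => dotv (vortex z) (e z.1)) 0 by rewrite /partial (@derive_val _ _ _ _ _ _ _ H).
  apply: is_derive_invariant => h /=.
  have E1 : (h *: delta_mx 0 i3 + x) 0 i1 = x 0 i1 by rewrite !mxE/= mulr0 add0r.
  have E2 : (h *: delta_mx 0 i3 + x) 0 i2 = x 0 i2 by rewrite !mxE/= mulr0 add0r.
  rewrite (He _ x)// /vortex /spin /pardist /= !(E1, E2).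
  by rewrite scaler0 add0r.
have rad (y z : 'rV[R]_3) : y 0 i1 = z 0 i1 -> y 0 i2 = z 0 i2 -> Defs.radius y = Defs.radius z.
  by rewrite /Defs.radius => -> ->.
by move=> _; split; apply: inv => y z yz1 yz2; rewrite /e_r /e_theta (rad _ _ yz1 yz2) yz1 yz2.
Qed.

Lemma vortex_solution :
  NS_solution T vortex_force (fun x => vortex (x, 0)) vortex (fun=> 0).
Proof.
split => //.
- exact: weightedv_smooth weighted_vortex.
- exact: smooth_on0.
- by move=> [x t] [_ /= /andP[_ tT]]; exact: divergence_vortex.
- move=> x t [rx _] _.
  have r1 : x 0 i1 ^+ 2 + x 0 i2 ^+ 2 = 1.
    have := congr1 (fun r => r ^+ 2) rx.
    by rewrite /Defs.radius /= sqr_sqrtr ?expr1n// addr_ge0// sqr_ge0.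
  by rewrite /vortex /spin /= r1 subrr mul0r scale0r.
- exact: vortex_total_slip.
Qed.

End Vortex.

(** * Mixed norms of parabolic singularities *)

Section Integrability.
Variable R : realType.
Local Notation mu := (@lebesgue_measure R).

(** The integral of a nonnegative function is the supremum over the simple
    functions below it, hence monotone even without measurability; this applies
    to the spatial norm as a function of time. *)
Lemma ge0_le_integralT d (X : measurableType d) (m : {measure set X -> \bar R})
    (f g : X -> \bar R) : (forall x, 0 <= f x)%E -> (forall x, f x <= g x)%E ->
  (\int[m]_x f x <= \int[m]_x g x)%E.
Proof.
move=> f0 fg; have g0 x : (0 <= g x)%E by exact: le_trans (fg x).
rewrite !ge0_integralTE//; apply: le_ereal_sup => _ [h hf <-].
by exists h => // x; exact: le_trans (hf x) (fg x).
Qed.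

Lemma powRN_le (a b c : R) : 0 < a -> a <= b -> 0 <= c -> b `^ (- c) <= a `^ (- c).
Proof.
move=> a0 ab c0; have b0 := lt_le_trans a0 ab.
rewrite !powRN lef_pV2 ?posrE ?powR_gt0//.
by apply: ge0_ler_powR => //; rewrite nnegrE ltW.
Qed.

Lemma powRDpos (a r s : R) : 0 < a -> a `^ (r + s) = a `^ r * a `^ s.
Proof. by move=> a0; rewrite powRD//; apply/implyP => _; rewrite gt_eqF. Qed.

(** The derivative of [x * (x ^+ 2 + e) `^ (- c / 2)] is at least [1 - c] times the
    integrand, and that function is at most 1 in absolute value at the end points,
    whence a bound that does not depend on [e]. *)
Lemma integral_regularized_power (e c : R) : 0 < e -> 0 <= c < 1 ->
  (\int[mu]_(x in `[(-1)%R, 1%R]) ((x ^+ 2 + e) `^ (- (c / 2)))%:E <= (2 / (1 - c))%:E)%E.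
Proof.
move=> e0 /andP[c0 c1].
have pos (x : R) : 0 < x ^+ 2 + e by rewrite ltr_wpDl// sqr_ge0.
have c1' : 0 < 1 - c by rewrite subr_gt0.
pose k (x : R) := (x ^+ 2 + e) `^ (- (c / 2)).
pose k' (x : R) := - (c / 2) * (x ^+ 2 + e) `^ (- (c / 2) - 1) * (2 * x).
pose F (x : R) := (1 - c)^-1 * (x * k x).
pose f (x : R) := (1 - c)^-1 * (k x + x * k' x).
have dk (x : R) : is_derive x 1 k (k' x).
  have dq : is_derive x (1 : R) (fun x : R => x ^+ 2 + e) (2 * x).
    rewrite (_ : (fun x => _) = (fun x : R => x * x + e)); last first.
      by apply/funext => y; rewrite expr2.
    apply: is_derive_eq; rewrite addr0 /GRing.scale/=; ring.
  exact: (@is_derive1_comp R (fun y => y `^ (- (c / 2))) (fun x : R => x ^+ 2 + e) x _ _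
    (is_derive1_powR (- (c / 2)) (pos x)) dq).
have dF (x : R) : is_derive x 1 F (f x).
  have H := is_deriveZ (1 - c)^-1 (is_deriveM (is_derive_id x (1 : R)) (dk x)).
  by apply: (is_derive_eq H); rewrite /f /GRing.scale/=; ring.
have cderiv (g : R -> R) (x l : R) : is_derive x 1 g l -> {for x, continuous g}.
  by move=> [dg _]; exact/differentiable_continuous/derivable1_diffP.
have cp (r : R) (x : R) : {for x, continuous (fun x : R => (x ^+ 2 + e) `^ r)}.
  apply: (@continuous_comp _ _ _ (fun x : R => x ^+ 2 + e) (fun y => y `^ r)).
    by apply: cvgD; [exact: exprn_continuous|exact: cvg_cst].
  exact: (cderiv _ _ _ (is_derive1_powR r (pos x))).
have cf (x : R) : {for x, continuous f}.
  apply: cvgM; first exact: cvg_cst.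
  apply: cvgD; first exact: cp.
  apply: cvgM; first exact: cvg_id.
  apply: cvgM; first by apply: cvgM; [exact: cvg_cst|exact: cp].
  by apply: cvgM; [exact: cvg_cst|exact: cvg_id].
have kf (x : R) : k x <= f x.
  rewrite /f mulrC ler_pdivlMr// mulrBr mulr1 lerD2l -mulNr.
  have -> : x * k' x = - k x * (c * (x ^+ 2 / (x ^+ 2 + e))).
    rewrite /k' /k (_ : (x ^+ 2 + e) `^ (- (c / 2) - 1) =
      (x ^+ 2 + e) `^ (- (c / 2)) / (x ^+ 2 + e)).
      by field; rewrite gt_eqF.
    by rewrite powRDpos// powR_inv1// ltW.
  rewrite !mulNr lerN2 ler_wpM2l ?powR_ge0// ler_piMr//.
  by rewrite ler_pdivrMr// mul1r lerDl ltW.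
have k0 (x : R) : 0 <= k x by exact: powR_ge0.
apply: (@le_trans _ _ (\int[mu]_(x in `[(-1)%R, 1%R]) (f x)%:E)%E).
  rewrite [leLHS]integral_mkcond [leRHS]integral_mkcond; apply: ge0_le_integralT => x.
    by rewrite patchE; case: ifP => _ //; rewrite lee_fin; exact: k0.
  by rewrite !patchE; case: ifP => _ //; rewrite lee_fin; exact: kf.
have I11 : -1 <= 1 :> R by rewrite (le_trans _ ler01)// oppr_le0 ler01.
rewrite (@integral_derive R F f (-1) 1 I11 (fun x _ => dF x) (fun x _ => cf x)).
have kN : k (-1) = k 1 by rewrite /k sqrrN.
have k1 : k 1 <= 1.
  rewrite /k expr1n; apply: (@le_trans _ _ (1 `^ (- (c / 2)))); last by rewrite powR1.
  by apply: powRN_le => //; [rewrite lerDl ltW|rewrite divr_ge0].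
rewrite lee_fin /F kN mul1r mulN1r mulrN opprK -mulrDr mulrC.
by rewrite ler_wpM2r ?invr_ge0 ?(ltW c1')//; lra.
Qed.

(** The integrals over the intervals that stop short of [T] are bounded by the
    values of an antiderivative, and increase to the improper integral. *)
Lemma integral_time_power (T c K : R) : 0 < T -> 0 <= c < 1 -> 0 <= K ->
  (\int[mu]_(t in `]0%R, T[) (K * (T - t) `^ (- c))%:E < +oo)%E.
Proof.
move=> T0 /andP[c0 c1] K0.
have c1' : 0 < 1 - c by rewrite subr_gt0.
pose f (t : R) := K * (T - t) `^ (- c).
pose G (t : R) := - K / (1 - c) * (T - t) `^ (1 - c).
pose J (n : nat) : set R := `[0, T - T / n.+1%:R]%classic.
have JT n t : J n t -> 0 <= t /\ t < T.
  rewrite /J /= in_itv/= => /andP[-> /le_lt_trans tT]; split => //.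
  by apply: tT; rewrite ltrBlDr ltrDl divr_gt0.
have dp (r t : R) : t < T -> is_derive t 1 (fun t : R => (T - t) `^ r) (- (r * (T - t) `^ (r - 1))).
  move=> tT; have Tt : 0 < T - t by rewrite subr_gt0.
  have d1 : is_derive t (1 : R) (fun t : R => T - t) (- 1).
    by apply: (is_derive_eq (is_deriveB (is_derive_cst T t (1 : R)) (is_derive_id t (1 : R))));
      rewrite sub0r.
  apply: (is_derive_eq (@is_derive1_comp R (fun y => y `^ r) (fun t : R => T - t) t _ _
    (is_derive1_powR r Tt) d1)).
  by rewrite mulrN1.
have cderiv (g : R -> R) (x l : R) : is_derive x 1 g l -> {for x, continuous g}.
  by move=> [dg _]; exact/differentiable_continuous/derivable1_diffP.
have cf (t : R) : t < T -> {for t, continuous f}.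
  by move=> tT; apply: cvgM; [exact: cvg_cst|exact: (cderiv _ _ _ (dp (- c) t tT))].
have dG (t : R) : t < T -> is_derive t 1 G (f t).
  move=> tT; have H := is_deriveZ (- K / (1 - c)) (dp (1 - c) t tT).
  apply: (is_derive_eq H); rewrite /f /GRing.scale/= (_ : 1 - c - 1 = - c); last by ring.
  by field; rewrite gt_eqF.
have f0 (t : R) : (0 <= (f t)%:E)%E by rewrite lee_fin mulr_ge0// powR_ge0.
have IJ n : (\int[mu]_(t in J n) (f t)%:E <= (K / (1 - c) * T `^ (1 - c))%:E)%E.
  have Tn : 0 <= T - T / n.+1%:R.
    by rewrite subr_ge0 ler_pdivrMr// ler_peMr ?ler1n// ltW.
  have inJ t : 0 <= t <= T - T / n.+1%:R -> t < T.
    by move=> tI; have [] := JT n t; rewrite /J /= ?in_itv.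
  rewrite (@integral_derive R G f 0 _ Tn (fun t tI => dG t (inJ t tI)) (fun t tI => cf t (inJ t tI))).
  rewrite lee_fin /G subr0 (_ : _ - _ = K / (1 - c) *
    (T `^ (1 - c) - (T - (T - T / n.+1%:R)) `^ (1 - c))); last by ring.
  by rewrite ler_wpM2l ?divr_ge0 ?(ltW c1')// gerBl powR_ge0.
have sub : `]0, T[%classic `<=` \bigcup_n J n.
  move=> t /=; rewrite in_itv/= => /andP[t0 tT].
  have Tt : 0 < (T - t) / T by rewrite divr_gt0// subr_gt0.
  have [n] := ltr_add_invr Tt; rewrite add0r ltr_pdivlMr// => nT.
  exists n => //; rewrite /J /= in_itv/= (ltW t0)/= lerBrDr -lerBrDl.
  by rewrite mulrC ltW.
have mJ (n : nat) : measurable (J n : set (measurableTypeR R)) by exact: measurable_itv.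
have mfJ n : measurable_fun (J n) (EFin \o f).
  have cJ : {within J n, continuous f}.
    by apply: continuous_in_subspaceT => t /set_mem /JT[_]; exact: cf.
  by apply/measurable_EFinP; exact: (subspace_continuous_measurable_fun (mJ n) cJ).
have ndJ : nondecreasing_seq J.
  move=> m n mn; rewrite subsetEset => t; rewrite /J /= !in_itv/= => /andP[-> /le_trans]; apply.
  rewrite lerD2l lerN2; apply: ler_wpM2l; first exact: ltW.
  by rewrite lef_pV2 ?posrE// ler_nat.
have lim := @ge0_nondecreasing_set_cvg_integral _ (measurableTypeR R) R J (EFin \o f) mu ndJ mJ mfJ (fun _ t _ => f0 t).
apply: (@le_lt_trans _ _ (\int[mu]_(t in \bigcup_n J n) (f t)%:E)%E).
  rewrite [leLHS]integral_mkcond [leRHS]integral_mkcond; apply: ge0_le_integralT => t.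
    by rewrite patchE; case: ifP => _ //; exact: f0.
  rewrite !patchE; case: ifPn => [/set_mem tI|_]; first by rewrite mem_set//; exact: sub.
  by case: ifP => _ //; exact: f0.
apply: (@le_lt_trans _ _ (K / (1 - c) * T `^ (1 - c))%:E); last exact: ltry.
rewrite -(cvg_lim _ lim)//; apply: lime_le; first by apply/cvg_ex; exists (\int[mu]_(x in \bigcup_i J i) (f x)%:E)%E.
by apply: nearW => n; exact: IJ.
Qed.

End Integrability.

Section MixedNorm.
Variable R : realType.
Local Notation mu := (@lebesgue_measure R).
Local Notation mu3 := (@lebesgue3 R).
Local Notation Y := pardist.

Lemma ge0_integral_prod d1 d2 (X1 : measurableType d1) (X2 : measurableType d2)
    (m1 : {sigma_finite_measure set X1 -> \bar R})
    (m2 : {sigma_finite_measure set X2 -> \bar R}) (f : X1 -> \bar R) (g : X2 -> \bar R) :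
  measurable_fun setT f -> measurable_fun setT g ->
  (forall x, 0 <= f x)%E -> (forall y, 0 <= g y)%E ->
  (\int[m1 \x m2]_z (f z.1 * g z.2) = \int[m1]_x f x * \int[m2]_y g y)%E.
Proof.
move=> mf mg f0 g0.
rewrite (fubini_tonelli1 (fun z => f z.1 * g z.2)%E); last by move=> z; exact: mule_ge0.
  rewrite /fubini_F /=; under eq_integral do rewrite ge0_integralZl//.
  by rewrite ge0_integralZr//; exact: integral_ge0.
apply: emeasurable_funM.
  exact: (measurableT_comp mf measurable_fst).
exact: (measurableT_comp mg measurable_snd).
Qed.

Section horizontal_power.
Variables (e c : R).
Hypotheses (e0 : 0 < e) (c01 : 0 <= c < 1).

Let k : R -> \bar R := (fun x => ((x ^+ 2 + e) `^ (- (c / 2)))%:E) \_ `[-1, 1].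
Let one : R -> \bar R := (cst 1%E) \_ `[0, 1].

Let k0 x : (0 <= k x)%E.
Proof. by rewrite /k patchE; case: ifP => _ //; rewrite lee_fin powR_ge0. Qed.

Let one0 x : (0 <= one x)%E.
Proof. by rewrite /one patchE; case: ifP. Qed.

Let mk : measurable_fun setT (k : measurableTypeR R -> \bar R).
Proof.
apply: (measurable_restrictT _ _).1; first exact: measurable_itv.
apply/measurable_EFinP; apply: measurable_funTS.
apply: (measurableT_comp (measurable_powR _)).
by apply: measurable_funD => //; exact: measurable_funX.
Qed.

Let mone : measurable_fun setT (one : measurableTypeR R -> \bar R).
Proof.
by apply: (measurable_restrictT _ _).1; [exact: measurable_itv|exact: measurable_cst].
Qed.

(** Enclosing the cylinder in a box splits the integral of the singular
    horizontal factor into two one-dimensional ones. *)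
Lemma integral_D3_power (M : R) : 0 <= M ->
  (\int[mu3]_y ((fun y : triple R => (M * ((y.1.1 ^+ 2 + e) `^ (- (c / 2)) *
    (y.1.2 ^+ 2 + e) `^ (- (c / 2))))%:E) \_ (@D3 R)) y <= (M * (2 / (1 - c)) ^+ 2)%:E)%E.
Proof.
move=> M0.
pose g2 (x : measurableTypeR R * measurableTypeR R) : \bar R := (k x.1 * k x.2)%E.
have g20 x : (0 <= g2 x)%E by exact: mule_ge0.
have mg2 : measurable_fun setT g2.
  apply: emeasurable_funM.
    exact: (measurableT_comp mk measurable_fst).
  exact: (measurableT_comp mk measurable_snd).
apply: (@le_trans _ _ (\int[mu3]_y (M%:E * (g2 y.1 * one y.2)))%E).
  apply: ge0_le_integralT => y; rewrite patchE; case: ifPn => [/set_mem Dy|_] //.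
  - by rewrite lee_fin !mulr_ge0 ?powR_ge0.
  - have := cylinder_coord i1 Dy; have := cylinder_coord i2 Dy.
    rewrite !point3E !ler_norml => h2 h1.
    have /D3P[_ h3] := Dy.
    by rewrite /g2 /k /one !patchE !mem_set ?mule1//= in_itv.
  - by rewrite mule_ge0// ?lee_fin// mule_ge0.
rewrite ge0_integralZl//; last first.
- by move=> y _; exact: mule_ge0.
- apply: emeasurable_funM.
    exact: (measurableT_comp mg2 measurable_fst).
  exact: (measurableT_comp mone measurable_snd).
rewrite EFinM lee_pmul//; first by apply: integral_ge0 => y _; exact: mule_ge0.
rewrite [leLHS](ge0_integral_prod (@lebesgue2 R) mu mg2 mone g20 one0).
rewrite (_ : \int[mu]_x one x = 1)%E ?mule1; last first.
  rewrite /one -integral_mkcond integral_cst//= mul1e lebesgue_measure_itv/= lte01.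
  by rewrite oppr0 adde0.
rewrite [leLHS](ge0_integral_prod mu mu mk mk k0 k0).
have Ik : (\int[mu]_x k x <= (2 / (1 - c))%:E)%E.
  by rewrite /k -integral_mkcond; exact: integral_regularized_power.
by rewrite expr2 EFinM lee_pmul//; exact: integral_ge0.
Qed.

End horizontal_power.
End MixedNorm.

Section Membership.
Variables (R : realType) (T : R).
Local Notation mu := (@lebesgue_measure R).
Local Notation mu3 := (@lebesgue3 R).
Local Notation Y := (@pardist R T).

(** Interpolating the parabolic singularity: part of the exponent is given to
    time, and the rest is shared between the two horizontal coordinates. *)
Lemma pardist_powN_le (x : 'rV[R]_3) (t al be : R) : t < T -> 0 <= al -> 0 <= be ->
  Y (x, t) `^ (- (al + be)) <= (T - t) `^ (- al) *
    ((x 0 i1 ^+ 2 + (T - t) / 2) `^ (- (be / 2)) *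
     (x 0 i2 ^+ 2 + (T - t) / 2) `^ (- (be / 2))).
Proof.
move=> tT al0 be0.
have tau0 : 0 < T - t by rewrite subr_gt0.
have sq1 := sqr_ge0 (x 0 i1); have sq2 := sqr_ge0 (x 0 i2).
have Y0 : 0 < Y (x, t) by exact: pardist_gt0.
rewrite opprD powRDpos// ler_pM ?powR_ge0//.
  by apply: powRN_le => //; rewrite /pardist/=; lra.
have -> : - be = - (be / 2) + - (be / 2) by field.
rewrite powRDpos// ler_pM ?powR_ge0//.
- by apply: powRN_le; [|rewrite /pardist/=|]; lra.
- by apply: powRN_le; [|rewrite /pardist/=|]; lra.
Qed.

(** At each time the spatial norm is finite because [be * p < 1], uniformly up to
    the factor that carries the time exponent. *)
Lemma LpD_bound (u : spacetime R -> 'rV[R]_3) (t p al be C : R) : t < T -> 1 <= p ->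
  0 <= al -> 0 <= be -> be * p < 1 -> 0 <= C ->
  (forall x, cylinder x -> enorm (u (x, t)) <= C * Y (x, t) `^ (- (al + be))) ->
  (LpD p%:E (fun x => u (x, t)) <=
    (C * ((2 / (1 - be * p)) ^+ 2) `^ p^-1 * (T - t) `^ (- al))%:E)%E.
Proof.
move=> tT p1 al0 be0 bep C0 Hu.
have p0 : 0 < p by exact: lt_le_trans p1.
have tau0 : 0 < T - t by rewrite subr_gt0.
have e0 : 0 < (T - t) / 2 by rewrite divr_gt0.
pose M := (C * (T - t) `^ (- al)) `^ p.
have M0 : 0 <= M by exact: powR_ge0.
have c01 : 0 <= be * p < 1 by rewrite bep andbT mulr_ge0// ltW.
have K0 : 0 <= (2 / (1 - be * p)) ^+ 2 by exact: sqr_ge0.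
have En (x : 'rV[R]_3) : 0 <= enorm x by exact: sqrtr_ge0.
rewrite /LpD unlock.
apply: (@le_trans _ _ ((M * (2 / (1 - be * p)) ^+ 2)%:E `^ p^-1)%E); last first.
  rewrite poweR_EFin lee_fin powRM// /M -powRrM mulfV ?gt_eqF// powRr1.
    by rewrite mulrAC.
  by rewrite mulr_ge0// powR_ge0.
apply: gt0_ler_poweR; rewrite ?invr_ge0 ?(ltW p0)// ?in_itv/= ?andbT ?leey//.
- by rewrite integral_ge0// => y _; exact: poweR_ge0.
- by rewrite lee_fin mulr_ge0.
apply: le_trans (integral_D3_power e0 c01 M0).
apply: ge0_le_integralT => y; first exact: poweR_ge0.
rewrite !patchE; case: ifPn => [/set_mem Dy|_]; last first.
  by rewrite abse0 poweR0r// gt_eqF.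
rewrite /= lee_fin ger0_norm//.
apply: (@le_trans _ _ ((C * ((T - t) `^ (- al) *
    ((y.1.1 ^+ 2 + (T - t) / 2) `^ (- (be / 2)) *
     (y.1.2 ^+ 2 + (T - t) / 2) `^ (- (be / 2))))) `^ p)).
  apply: ge0_ler_powR; rewrite ?nnegrE ?(ltW p0)//.
    by rewrite !mulr_ge0 ?powR_ge0.
  apply: (le_trans (Hu _ Dy)); rewrite ler_wpM2l//.
  by have := pardist_powN_le (point3 y) tT al0 be0; rewrite !point3E.
rewrite mulrA powRM ?mulr_ge0 ?powR_ge0// -/M ler_wpM2l//.
rewrite powRM ?powR_ge0// -!powRrM.
by rewrite (_ : - (be / 2) * p = - (be * p / 2))//; field.
Qed.

Lemma in_LqLpD_of_bound (u : spacetime R -> 'rV[R]_3) (q p al be C : R) :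
  0 < T -> 1 <= q -> 1 <= p -> 0 <= al -> al * q < 1 -> 0 <= be -> be * p < 1 -> 0 <= C ->
  (forall z, z.2 < T -> {for z, continuous u}) ->
  (forall x t, cylinder x -> 0 < t < T -> enorm (u (x, t)) <= C * Y (x, t) `^ (- (al + be))) ->
  in_LqLpD T q%:E p%:E u.
Proof.
move=> T0 q1 p1 al0 alq be0 bep C0 cu Hu; split.
  move=> i; have mI : measurable (`]0, T[%classic : set (measurableTypeR R)) by [].
  apply: (continuous_measurable_event (h := fun z => u z 0 i) (measurable_slab mI)).
  move=> [x t] [_ /=]; rewrite in_itv/= => /andP[_ tT].
  by apply: continuous_coord; exact: cu.
have q0 : 0 < q by exact: lt_le_trans q1.
pose K := C * ((2 / (1 - be * p)) ^+ 2) `^ p^-1.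
have K0 : 0 <= K by rewrite mulr_ge0// powR_ge0.
rewrite /LqLpD unlock; apply: poweR_lty.
have aq : 0 <= al * q < 1 by rewrite alq andbT mulr_ge0// ltW.
apply: le_lt_trans (integral_time_power T0 aq (powR_ge0 K q)).
rewrite [leRHS]integral_mkcond; apply: ge0_le_integralT => t; first exact: poweR_ge0.
rewrite !patchE; case: ifPn => [/set_mem|_]; last by rewrite abse0 poweR0r// gt_eqF.
rewrite /= in_itv/= => /andP[t0 tT].
have B := LpD_bound tT p1 al0 be0 bep C0 (fun x Dx => Hu x t Dx (introT andP (conj t0 tT))).
rewrite gee0_abs ?Lnorm_ge0//.
apply: (@le_trans _ _ ((K * (T - t) `^ (- al))%:E `^ q)%E).
  apply: gt0_ler_poweR; rewrite ?(ltW q0)// ?in_itv/= ?andbT ?leey ?Lnorm_ge0//.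
  by rewrite andbT lee_fin mulr_ge0// powR_ge0.
by rewrite poweR_EFin lee_fin powRM ?powR_ge0// -powRrM mulNr.
Qed.

End Membership.

(** * Blow-up of the supremum norm *)

Section BlowUp.
Variable R : realType.
Local Notation mu3 := (@lebesgue3 R).

Lemma weightedv_enorm (T w : R) (u : spacetime R -> 'rV[R]_3) : weightedv T w u ->
  exists2 C, 0 <= C & forall x t, cylinder x -> 0 < t < T ->
    enorm (u (x, t)) <= C * pardist T (x, t) `^ w.
Proof.
move=> [h wh uh].
have B i : exists C, 0 <= C /\ forall z, z.2 < T -> pardist T z <= 1 + T ->
    `|h i z| <= C * pardist T z `^ w.
  by have [C C0 HC] := weighted_bound (1 + T) (wh i); exists C.
have [C HC] := choice B.
exists (C i1 + C i2 + C i3); first by rewrite !addr_ge0//; case: (HC i1) (HC i2) (HC i3) => ? _ [? _] [? _].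
move=> x t Dx /andP[t0 tT].
have YB : pardist T (x, t) <= 1 + T.
  have [+ _] := Dx; rewrite radius_le1 /pardist/= => ?; lra.
have ui i : `|u (x, t) 0 i| <= C i * pardist T (x, t) `^ w.
  by rewrite uh//; case: (HC i) => _; apply.
rewrite !mulrDl; apply: (@le_trans _ _ (`|u (x, t) 0 i1| + `|u (x, t) 0 i2| + `|u (x, t) 0 i3|)).
  rewrite /enorm -[leRHS]ger0_norm ?addr_ge0// -sqrtr_sqr ler_wsqrtr// dotvE.
  rewrite -!expr2 -(real_normK (num_real (u (x, t) 0 i1))).
  rewrite -(real_normK (num_real (u (x, t) 0 i2))) -(real_normK (num_real (u (x, t) 0 i3))).
  have := normr_ge0 (u (x, t) 0 i1); have := normr_ge0 (u (x, t) 0 i2).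
  by have := normr_ge0 (u (x, t) 0 i3); nra.
by rewrite !lerD.
Qed.

Lemma continuous_enorm (V : topologicalType) (g : V -> 'rV[R]_3) x :
  {for x, continuous g} -> {for x, continuous (fun x => enorm (g x))}.
Proof.
move=> cg; have ci i : {for x, continuous (fun x => g x 0 i)}.
  exact: (@continuous_comp _ _ _ g (fun x => x 0 i) x cg (@coord_cts R i _)).
apply: (@continuous_comp _ _ _ (fun x => dotv (g x) (g x)) Num.sqrt); last exact: sqrt_continuous.
rewrite (_ : (fun x => _) = (fun x => g x 0 i1 * g x 0 i1 + g x 0 i2 * g x 0 i2
  + g x 0 i3 * g x 0 i3)); last by apply/funext => y; rewrite dotvE.
by apply: cvgD; [apply: cvgD|]; (apply: cvgM; exact: ci).
Qed.

(** The essential supremum dominates the values at points of continuity, since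
    every neighbourhood of a point of the cylinder meets it in positive volume. *)
Lemma LpDy_ge (g : 'rV[R]_3 -> 'rV[R]_3) x0 : cylinder x0 -> {for x0, continuous g} ->
  ((enorm (g x0))%:E <= LpD +oo%E g)%E.
Proof.
move=> Dx0 /continuous_enorm cg; rewrite /LpD unlock.
set f := (f in ess_sup _ (abse \o f)).
have pos p r : 0 < r -> (0 < mu3 (box3 p r))%E by exact: lebesgue3_box3.
have mb p r : measurable (@box3 R p r) by apply: measurableX => //; exact: measurableX.
have muT : (0 < mu3 setT)%E.
  by apply: (lt_le_trans (pos (0, 0, 0) 1 ltr01)); apply: le_measure; rewrite ?inE.
rewrite [X in if X then _ else _]muT leNgt; apply/negP => Slt.
have S0 : (0 <= ess_sup mu3 (abse \o f))%E.
  by apply: ess_sup_gee => //; apply: nearW => y; exact: abse_ge0.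
have Sfin : ess_sup mu3 (abse \o f) \is a fin_num.
  by rewrite ge0_fin_numE// (lt_trans Slt)// ltry.
pose s := fine (ess_sup mu3 (abse \o f)).
have sx0 : s < enorm (g x0) by rewrite -lte_fin /s fineK.
have nO : nbhs x0 [set x | s < enorm (g x)] by exact: (cvgr_gt _ cg).
have [p [r [r0 Hb]]] := cylinder_box Dx0 nO.
have : mu3.-negligible (box3 p r).
  have /ess_supP := lexx (ess_sup mu3 (abse \o f)).
  apply: negligibleS => y yb /=; apply/negP; rewrite -ltNge.
  have [Dy Oy] := Hb _ yb.
  by rewrite -(fineK Sfin) /f patchE mem_set//= lte_fin (lt_le_trans Oy)// ler_norm.
move/negligibleP => /(_ (mb _ _)) m0.
by have := pos p r r0; rewrite m0 ltxx.
Qed.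

(** At distance [Num.sqrt (T - t)] from the axis both terms of [pardist] are equal
    to [T - t]. *)
Lemma vortex_peak (T b t : R) : T - 2^-1 < t < T -> 0 <= b ->
  2^-1 * 2 `^ (- b) * (T - t) `^ (2^-1 - b) <=
    enorm (vortex T b (point3 (Num.sqrt (T - t), 0, 0), t)).
Proof.
move=> /andP[tT2 tT] b0.
have tau0 : 0 < T - t by rewrite subr_gt0.
have sq : Num.sqrt (T - t) ^+ 2 = T - t by rewrite sqr_sqrtr// ltW.
set x := point3 _.
have x1 : x 0 i1 = Num.sqrt (T - t) by rewrite point3E.
have x2 : x 0 i2 = 0 by rewrite point3E.
have spinE : spin T b (x, t) = (1 - (T - t)) * (2 `^ (- b) * (T - t) `^ (- b)).
  rewrite /spin /pardist/= x1 x2 sq expr0n/= addr0 -powRM ?ltW//.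
  by congr (_ * _ `^ _); ring.
have -> : enorm (vortex T b (x, t)) = spin T b (x, t) * Num.sqrt (T - t).
  have s0 : 0 <= spin T b (x, t).
    by rewrite spinE mulr_ge0 ?mulr_ge0 ?powR_ge0//; lra.
  rewrite /enorm dotvE !vortexE /= x1 x2 -[RHS]ger0_norm; last by rewrite mulr_ge0 ?sqrtr_ge0.
  by rewrite -sqrtr_sqr; congr Num.sqrt; ring.
rewrite (_ : 2^-1 - b = - b + 2^-1); last by ring.
rewrite powRDpos// powR12_sqrt ?(ltW tau0)// spinE.
rewrite !mulrA ler_wpM2r ?sqrtr_ge0// ler_wpM2r ?powR_ge0// ler_wpM2r ?powR_ge0//; lra.
Qed.

Lemma vortex_blows_up (T b : R) : 2^-1 < b ->
  LpD +oo%E (fun x => vortex T b (x, t)) @[t --> T^'-] --> +oo%E.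
Proof.
move=> b2; have b0 : 0 < b by lra.
have d0 : 0 < b - 2^-1 by rewrite subr_gt0.
have c0 : 0 < 2^-1 * 2 `^ (- b) :> R by rewrite mulr_gt0// powR_gt0.
set c := 2^-1 * _ in c0.
apply/cvgeyPge => A.
pose A' := Num.max A 1.
have A0 : 0 < A' by rewrite lt_max ltr01 orbT.
(* the remaining time at which the lower bound [c * tau `^ (2^-1 - b)] of the
   peak equals [A'] *)
pose tau1 := (c / A') `^ (b - 2^-1)^-1.
have tau10 : 0 < tau1 by rewrite powR_gt0// divr_gt0.
near=> t.
have tT : t < T by near: t; exact: nbhs_left_lt.
have t2 : T - 2^-1 < t by near: t; apply: nbhs_left_gt; rewrite ltrBlDr ltrDl invr_gt0.
have t1 : T - tau1 < t by near: t; apply: nbhs_left_gt; rewrite ltrBlDr ltrDl.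
have tau0 : 0 < T - t by rewrite subr_gt0.
have Dx : cylinder (point3 (Num.sqrt (T - t), 0, 0)).
  apply/D3P => /=; rewrite sqr_sqrtr; last exact: ltW.
  rewrite expr0n/= addr0 lexx ler01; split => //.
  have : T - t < 2^-1 by rewrite ltrBlDr -ltrBlDl.
  lra.
have cv : {for point3 (Num.sqrt (T - t), 0, 0), continuous (fun x => vortex T b (x, t))}.
  have cvt : {for (point3 (Num.sqrt (T - t), 0, 0), t), continuous (vortex T b)}.
    have [H _] := weightedv_derive None (weighted_vortex T b).
    by have [] := H (point3 (Num.sqrt (T - t), 0, 0), t) tT.
  have ct : {for point3 (Num.sqrt (T - t), 0, 0), continuous (fun x : 'rV[R]_3 => (x, t))}.
    exact: (@cvg_pair _ _ _ (nbhs _) (nbhs _) (nbhs t) _ _ _ id (fun=> t) cvg_id (cvg_cst t)).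
  exact: (@continuous_comp _ _ _ (fun x : 'rV[R]_3 => (x, t)) (vortex T b) _ ct cvt).
apply: (le_trans _ (LpDy_ge Dx cv)); rewrite lee_fin.
apply: (le_trans _ (vortex_peak _ (ltW b0))); last by rewrite t2 tT.
rewrite -/c (@le_trans _ _ A') ?le_max ?lexx//.
have -> : A' = c * tau1 `^ (2^-1 - b).
  have E : (b - 2^-1)^-1 * (2^-1 - b) = -1 by rewrite -[2^-1 - b]opprB mulrN mulVf// gt_eqF.
  rewrite /tau1 -powRrM E powR_inv1; last by rewrite divr_ge0 ?ltW.
  by rewrite invf_div mulrCA mulfV ?mulr1// gt_eqF.
rewrite ler_wpM2l ?(ltW c0)// (_ : 2^-1 - b = - (b - 2^-1)); last by ring.
apply: powRN_le => //; last exact: ltW.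
by rewrite lerBlDr -lerBlDl ltW.
Unshelve. all: by end_near. Qed.

End BlowUp.

(** * Conclusion *)

(** The exponents: [b] slightly above [1 / 2] makes the velocity blow up while
    keeping it in any space of finite exponents; the exponent [b + 1 / 2] of the
    force is shared between time and space in proportion to [1 / q] and [1 / p]. *)
Lemma exponents_exist (R : realType) (q p qt : R) : 1 <= q -> 1 <= p ->
  p < 1 + q^-1 -> 1 <= qt ->
  exists b al be : R, [/\ 2^-1 < b <= 1, (b - 2^-1) * qt < 1,
    0 <= al /\ al * q < 1, 0 <= be /\ be * p < 1 & al + be = b + 2^-1].
Proof.
move=> q1 p1 pq qt1.
have q0 : 0 < q by exact: lt_le_trans q1.
have p0 : 0 < p by exact: lt_le_trans p1.
have qt0 : 0 < qt by exact: lt_le_trans qt1.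
have iq0 : 0 < q^-1 by rewrite invr_gt0.
have ip0 : 0 < p^-1 by rewrite invr_gt0.
have iq1 : q^-1 <= 1 by rewrite invf_le1.
have ip1 : p^-1 <= 1 by rewrite invf_le1.
have iqt1 : qt^-1 <= 1 by rewrite invf_le1.
have iqt0 : 0 < qt^-1 by rewrite invr_gt0.
have pp : p * p^-1 = 1 by rewrite mulfV// gt_eqF.
have eta0 : 1 < p^-1 + q^-1 by nra.
pose d := Num.min ((p^-1 + q^-1 - 1) / 2) (qt^-1 / 2).
have d0 : 0 < d by rewrite lt_min !divr_gt0 ?subr_gt0.
have d1 : d <= (p^-1 + q^-1 - 1) / 2 by rewrite ge_min lexx.
have d2 : d <= qt^-1 / 2 by rewrite ge_min lexx orbT.
have qq : qt * qt^-1 = 1 by rewrite mulfV// gt_eqF.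
pose l := (1 + d) / (p^-1 + q^-1).
have s0 : 0 < p^-1 + q^-1 by exact: addr_gt0.
have l0 : 0 <= l by rewrite divr_ge0 ?ltW//; lra.
have l1 : l < 1 by rewrite ltr_pdivrMr// mul1r; lra.
exists (2^-1 + d), (l / q), (l / p); split.
- by apply/andP; split; lra.
- by nra.
- by split; [rewrite divr_ge0// ltW|rewrite divfK// gt_eqF].
- by split; [rewrite divr_ge0// ltW|rewrite divfK// gt_eqF].
- by rewrite -mulrDr (addrC q^-1) /l divfK ?gt_eqF//; lra.
Qed.

Theorem corollary4p3 (R : realType) (T : R) (q : \bar R) (p qt pt : R)
    (hT : 0 < T) (hq : (1 <= q)%E) (hp : 1 <= p)
    (hpq : (p%:E < 1 + q^-1)%E) (hqt : 1 <= qt) (hpt : 1 <= pt) :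
  exists (f : spacetime R -> 'rV[R]_3) (v0 : 'rV[R]_3 -> 'rV[R]_3)
         (v : spacetime R -> 'rV[R]_3) (P : spacetime R -> R),
    [/\ in_LqLpD T q p%:E f /\ smooth_on (domain T) f,
        NS_solution T f v0 v P,
        forall w Q, NS_solution T f v0 w Q ->
          forall z, domain T z -> w z = v z,
        in_LqLpD T qt%:E pt%:E v &
        LpD +oo%E (fun x => v (x, t)) @[t --> T^'-] --> +oo%E].
Proof.
have [r r1 qE] : exists2 r : R, 1 <= r & q = r%:E.
  case: q hq hpq => [r|_|//]; first by move=> ? _; exists r.
  by rewrite invey adde0 lte_fin ltNge hp.
rewrite qE in hpq *.
have r0 : 0 < r by exact: lt_le_trans r1.
have {}hpq : p < 1 + r^-1 by move: hpq; rewrite inver gt_eqF// -EFinD lte_fin.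
have [b [al [be [/andP[b2 b1] bqt [al0 alq] [be0 bep] albe]]]] :=
  exponents_exist r1 hp hpq hqt.
have wf := weighted_force T b1; have wv := weighted_vortex T b.
have sol := vortex_solution T b.
exists (vortex_force T b), (fun x => vortex T b (x, 0)), (vortex T b), (fun=> 0).
split => //.
- split; last exact: weightedv_smooth wf.
  have [C C0 HC] := weightedv_enorm wf.
  apply: (in_LqLpD_of_bound (al := al) (be := be) (C := C)) => //.
    by move=> z zT; have [H _] := weightedv_derive None wf; have [] := H z zT.
  by move=> x t Dx tT; rewrite albe (_ : - (b + 2^-1) = - 2^-1 - b) ?HC//; ring.
- by move=> w Q solw; exact: NS_solution_unique sol solw.
- have [C C0 HC] := weightedv_enorm wv.
  apply: (in_LqLpD_of_bound (al := b - 2^-1) (be := 0) (C := C)) => //.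
  + by rewrite subr_ge0 ltW.
  + by rewrite mul0r.
  + by move=> z zT; have [H _] := weightedv_derive None wv; have [] := H z zT.
  + by move=> x t Dx tT; rewrite addr0 opprB HC.
- exact: vortex_blows_up.
Qed.
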